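(* Let $q_0\in\mathbb{C}^*$ with $|q_0|>1$, let $\varepsilon>0$ be sufficiently close to $0$, and write $q=q_0^{\varepsilon}$, $p=1/q=q_0^{-\varepsilon}$. With the data $U$, $\mathcal{A}(z,t)$, $B_0(\varepsilon)$, $A_2$ and under the standing assumptions listed in the context, let $P(z,t,\varepsilon)$ be the Birkhoff connection matrix (defined in the context) of $$Y(z/q,t,\varepsilon)=\big(\mathrm{I}+(p-1)z\mathcal{A}(z,t)\big)Y(z,t,\varepsilon),$$ and let $Q(z,t,\varepsilon)$ be the Birkhoff connection matrix (defined in the context) of $$Y(z/q,t,\varepsilon)=(z-1)(z-t)\big(\mathrm{I}+(p-1)z\mathcal{A}(z,t)\big)Y(z,t,\varepsilon).$$ Then $$Q(z,t,\varepsilon)=\frac{\Theta_q(qz)^2\prod_{n=0}^{\infty}\left(1-q^{-n-1}\right)^2}{\Theta_q(-qz)\,\Theta_q\!\left(\frac{-qz}{t}\right)}\,\big(\mathrm{I}+(p-1)A_2\big)^2\,P(z,t,\varepsilon)\,\big(\Lambda_{q,B_0^{-1}(\varepsilon)}\big)^{-1}\,\frac{\Lambda_{q,t^{-1}B_0^{-1}(\varepsilon)}}{q^{3}}.$$ Furthermore, $Q$ is pseudo constant, that is $Q(z,qt,\varepsilon)=Q(z,t,\varepsilon)$ for all $t\in U$, if and only if $$P(z,qt,\varepsilon)=-P(z,t,\varepsilon)\,t^2B_0(\varepsilon)\quad\text{for all } t\in U.$$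
   Context: **Notation.** $\log$ is a fixed determination of the logarithm and $q_0^{a}=e^{a\log q_0}$; for $S\subset\mathbb{R}$, $q_0^{S}=\{q_0^{s}: s\in S\}$, and similarly for $q^{\mathbb{Z}}$. ''Distinct modulo $q^{\mathbb{Z}}$'' (resp. ''modulo $q_0^{\mathbb{R}}$'') means that no quotient of two of the numbers lies in $q^{\mathbb{Z}}$ (resp. $q_0^{\mathbb{R}}$). $\mathrm{I}$ is the identity matrix and $\mathbb{C}\{x\}$ is the ring of germs at $x=0$ of analytic functions. For $|q|>1$ set $\Theta_q(z)=\sum_{n\in\mathbb{Z}}q^{-n(n+1)/2}z^n$, so that $\Theta_q(qz)=z\Theta_q(z)$, and for $a\in\mathbb{C}^*$ set $\Lambda_{q,a}(z)=\Theta_q(z)/\Theta_q(z/a)$, so that $\Lambda_{q,a}(qz)=a\Lambda_{q,a}(z)$. For an invertible diagonalizable complex matrix $B=S\,\mathrm{Diag}(d_i)\,S^{-1}$ set $\Lambda_{q,B}=S\,\mathrm{Diag}(\Lambda_{q,d_i})\,S^{-1}$ (a matrix of meromorphic functions of $z\in\mathbb{C}^*$). **Normalized solutions and Birkhoff connection matrix.** Consider a system $Y(qz)=R(z)M(z)Y(z)$ with $R\in\mathbb{C}(z)\setminus\{0\}$ and $M\in \mathrm{GL}_2(\mathbb{C}(z))$ having no pole at $0$ and $\infty$, with $M(0)$ and $M(\infty)$ invertible, diagonalizable, and each having its distinct eigenvalues distinct modulo $q^{\mathbb{Z}}$. Let $\mu_0$ be the valuation of $R$ at $0$, $\mu_\infty$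 the degree of $R$ (so that $R(z)\sim r_\infty z^{\mu_\infty}$ at infinity), and let $r_0$, $r_\infty$ be the values of $z^{-\mu_0}R$ at $0$ and of $z^{-\mu_\infty}R$ at $\infty$. There are invertible matrix solutions, meromorphic on $\mathbb{C}^*$, of the form $$Y_0=\hat H_0(z)\,\Lambda_{q,r_0M(0)}\,\Theta_q(z)^{\mu_0},\qquad Y_\infty=\hat H_\infty(z)\,\Lambda_{q,r_\infty M(\infty)}\,\Theta_q(z)^{\mu_\infty},$$ with $\hat H_0(z)\in\mathrm{GL}_2(\mathbb{C}\{z\})$, $\hat H_\infty(z)\in\mathrm{GL}_2(\mathbb{C}\{z^{-1}\})$ and $\hat H_0(0)=\hat H_\infty(\infty)=\mathrm{I}$. The Birkhoff connection matrix of the system is $Y_\infty^{-1}Y_0$. For a system written as $Y(z/q)=N(z)Y(z)$, these notions are applied to the equivalent system $Y(qz)=N(qz)^{-1}Y(z)$. Explicitly, in the claim: - $P=Y_\infty^{-1}Y_0$ with $Y_0=\hat H_0\,\Lambda_{q,B_0^{-1}(\varepsilon)}$ and $Y_\infty=\hat H_\infty\,\Lambda_{q,(\mathrm{I}+(p-1)A_2)^{-1}}$. - $Q=W_\infty^{-1}W_0$ with $W_0=\hat F_0\,\Lambda_{q,t^{-1}B_0^{-1}(\varepsilon)}$ and $W_\infty=\hat F_\infty\,\Lambda_{q,q^{-2}(\mathrm{I}+(p-1)A_2)^{-1}}\,\Theta_q(z)^{-2}$. Here $\hat H_0,\hat F_0\in\mathrm{GL}_2(\mathbb{C}\{z\})$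 and $\hat H_\infty,\hat F_\infty\in \mathrm{GL}_2(\mathbb{C}\{z^{-1}\})$ (for each $t$) are equal to $\mathrm{I}$ at $z=0$, resp. $z=\infty$. **Data and standing assumptions.** - $U\subset\mathbb{C}^*$ is open, connected, and stable under $t\mapsto q_0^{\varepsilon}t$ for every $\varepsilon>0$. For all $t\in U$, the numbers $-1,1,t$ are distinct modulo $q_0^{\mathbb{R}}$. - For $t\in U$, $\mathcal{A}(z,t)=\frac{\mathcal{A}_0}{z}+\frac{\mathcal{A}_1}{z-1}+\frac{\mathcal{A}_t}{z-t}$, where $\mathcal{A}_0,\mathcal{A}_1,\mathcal{A}_t$ are $2\times2$ complex matrices (possibly depending on $t$, subject to the conditions below). - One can write $(z-1)(z-t)(\mathrm{I}+(p-1)z\mathcal{A}(z,t))=tB_0(\varepsilon)+A_1(t,\varepsilon)z+(\mathrm{I}+(p-1)A_2)z^2$, where $B_0(\varepsilon)\in\mathrm{GL}_2(\mathbb{C})$ is diagonalizable and independent of $t$ (it equals $\mathrm{I}+(p-1)\mathcal{A}_0$), $A_1(t,\varepsilon)$ is a $2\times 2$ complex matrix, and $A_2=\mathrm{Diag}(\kappa_1,\kappa_2)$ is independent of $t$ (it equals $\mathcal{A}_0+\mathcal{A}_1+\mathcal{A}_t$). The numbers $1+(p-1)\kappa_1$ and $1+(p-1)\kappa_2$ are nonzero. - The two eigenvalues of $B_0(\varepsilon)$ are equal or distinct modulo $q^{\mathbb{Z}}$; likewise $1+(p-1)\kappa_1$ and $1+(p-1)\kappa_2$ are equal or distinct modulo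 $q^{\mathbb{Z}}$. - There are $a_1,\dots,a_4\in\mathbb{C}^*$, independent of $t$ (possibly depending on $\varepsilon$), such that for all $t\in U$ the determinant of $tB_0(\varepsilon)+A_1(t,\varepsilon)z+(\mathrm{I}+(p-1)A_2)z^2$ equals $(1+(p-1)\kappa_1)(1+(p-1)\kappa_2)(z-ta_1)(z-ta_2)(z-a_3)(z-a_4)$. - The differential system $\frac{\mathrm{d}}{\mathrm{d}z}\widetilde Y=\mathcal{A}(z,t)\widetilde Y$ is non-resonant at $0$ and $\infty$: the eigenvalues of $\mathcal{A}_0$ do not differ by a nonzero integer, and neither do those of $A_2$.
   Formalization: The factor 1/q^3 in the formula for Q is replaced by q: with the stated conventions Θ_q(q^2 w) = q w^2 Θ_q(w), so the printed constant is off by q^4 (e.g. it fails for A = 0, B_0 = I, A_2 = 0). *)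

(* Defs.v *)
From HB Require Import structures.
From mathcomp Require Import all_boot all_order all_algebra.
From mathcomp Require Import complex.
From mathcomp Require Import all_classical all_reals all_analysis.
Set Implicit Arguments.
Unset Strict Implicit.
Unset Printing Implicit Defensive.
Import Order.TTheory GRing.Theory Num.Theory.
Import numFieldNormedType.Exports.
Local Open Scope classical_set_scope.
Local Open Scope ring_scope.

(* The type [R[i]] itself carries no topology in the libraries; going through
   its [numClosedFieldType] structure gives it the topology of the modulus. *)
Definition Cplx (R : realType) : numClosedFieldType := R[i]%C.

Section Defs.
Variable R : realType.
Local Notation C := (Cplx R).
Implicit Types (q z t a c : C) (A N Y P : C -> 'M[C]_2) (B G : 'M[C]_2).

(* e^x = e^(Re x) (cos (Im x) + i sin (Im x)) *)
Definition cexp (x : C) : C :=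
  Complex (expR (complex.Re x) * cos (complex.Im x))
          (expR (complex.Re x) * sin (complex.Im x)).

(* q0^s = e^(s log q0) for real s, with l the chosen value of log q0 *)
Definition qpow (l : C) (s : R) : C := cexp ((Complex s 0 : C) * l).

Definition qpow_R (l : C) : set C := [set qpow l s | s in [set: R]].
Definition qpow_Z q : set C := [set q ^ n | n in [set: int]].

Definition distinct_mod (E : set C) (s : seq C) : Prop :=
  forall i j : nat, (i < size s)%N -> (j < size s)%N -> i != j ->
    ~ E (s`_i / s`_j).

Definition eq_or_distinct_mod (E : set C) a c : Prop :=
  a = c \/ distinct_mod E [:: a; c].

(* Two-sided series: n = 0, 1, 2, ... and n = -1, -2, -3, ...; Negz n = -(n+1) *)
Definition bilateral_sum (u : int -> C) : C :=
  limn (series (fun n => u (Posz n))) + limn (series (fun n => u (Negz n))).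

(* n(n+1) is even, so the integer division is exact *)
Definition Theta q z : C :=
  bilateral_sum (fun n => q ^ (- ((n * (n + 1)) %/ 2)%Z) * z ^ n).

(* Theta q (q * z) = z * Theta q z, so Lambda q a (q * z) = a * Lambda q a z
   and Theta q (q^2 * z) = q * z^2 * Theta q z. *)
Definition Lambda q a z : C := Theta q z / Theta q (z / a).

(* For B = V Diag(d) V^-1, the matrix V Diag(Lambda q d_i z) V^-1 does not
   depend on the diagonalization (V, d), which is picked by [xget]. *)
Definition diagonalization B : 'M[C]_2 * 'rV[C]_2 :=
  xget (1%:M, 0)
    [set Vd | Vd.1 \in unitmx /\ B = Vd.1 *m diag_mx Vd.2 *m invmx Vd.1].

Definition LambdaM q B z : 'M[C]_2 :=
  let: (V, d) := diagonalization B in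
  V *m diag_mx (\row_i Lambda q (d 0 i) z) *m invmx V.

Definition analytic_at (f : C -> C) c : Prop :=
  exists (u : nat -> C) (r : C), 0 < r /\
    forall z, `|z - c| < r -> series (fun n => u n * (z - c) ^+ n) @ \oo --> f z.

Definition mx_analytic_at A c : Prop :=
  forall i j, analytic_at (fun z => A z i j) c.

Definition meromorphic_at (f : C -> C) c : Prop :=
  exists (g : C -> C) (k : nat), analytic_at g c /\
    \forall z \near c^', f z = g z / (z - c) ^+ k.

Definition mx_meromorphic A : Prop :=
  forall c, c != 0 -> forall i j, meromorphic_at (fun z => A z i j) c.

(* Meromorphic functions on C^* are represented by total functions whose
   values on a closed discrete subset of C^* are irrelevant. *)
Definition ae_Cstar (p : C -> Prop) : Prop :=
  forall c, c != 0 -> \forall z \near c^', p z.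

Definition mero_eq A Y : Prop := ae_Cstar (fun z => A z = Y z).

(* A(z) ~ B z^m at z = 0 *)
Definition leading_at_0 A (m : int) B : Prop :=
  exists G : C -> 'M[C]_2, [/\ mx_analytic_at G 0, G 0 = B &
    \forall z \near 0^', A z = z ^ m *: G z].

(* A(z) ~ B z^m at z = oo, in the coordinate w = 1/z *)
Definition leading_at_oo A (m : int) B : Prop :=
  leading_at_0 (fun w => A w^-1) (- m) B.

Definition solution q A Y : Prop :=
  [/\ mx_meromorphic Y,
      ae_Cstar (fun z => Y z \in unitmx) &
      ae_Cstar (fun z => Y (q * z) = A z *m Y z)].

(* For A = R M with R a nonzero rational function, M(0) and M(oo) invertible,
   the leading terms of A at 0 and oo are r_0 M(0) z^mu_0 and
   r_oo M(oo) z^mu_oo. *)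
Definition normalized_solution_0 q A Y : Prop :=
  exists (mu : int) (B : 'M[C]_2) (H : C -> 'M[C]_2),
    [/\ leading_at_0 A mu B, B \in unitmx & diagonalizable B] /\
    [/\ mx_analytic_at H 0, H 0 = 1%:M, solution q A Y &
        mero_eq Y (fun z => Theta q z ^ mu *: (H z *m LambdaM q B z))].

Definition normalized_solution_oo q A Y : Prop :=
  exists (mu : int) (B : 'M[C]_2) (H : C -> 'M[C]_2),
    [/\ leading_at_oo A mu B, B \in unitmx & diagonalizable B] /\
    [/\ mx_analytic_at H 0, H 0 = 1%:M, solution q A Y &
        mero_eq Y (fun z => Theta q z ^ mu *: (H z^-1 *m LambdaM q B z))].

(* P is the connection matrix of Y(q z) = A(z) Y(z) *)
Definition Birkhoff_matrix q A P : Prop :=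
  exists Y0 Yoo : C -> 'M[C]_2,
    [/\ normalized_solution_0 q A Y0, normalized_solution_oo q A Yoo &
        mero_eq P (fun z => invmx (Yoo z) *m Y0 z)].

(* P is the connection matrix of Y(z / q) = N(z) Y(z) *)
Definition Birkhoff_matrix_inv q N P : Prop :=
  Birkhoff_matrix q (fun z => invmx (N (q * z))) P.

Definition fuchsian (A0 A1 At : C -> 'M[C]_2) z t : 'M[C]_2 :=
  z^-1 *: A0 t + (z - 1)^-1 *: A1 t + (z - t)^-1 *: At t.

Definition nonresonant B : Prop :=
  forall a c, eigenvalue B a -> eigenvalue B c ->
    forall n : int, n != 0 -> a - c <> n%:~R.

Definition infprod (u : nat -> C) : C := limn (fun m : nat => \prod_(0 <= n < m) u n).

End Defs.

(* Main.v *)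
Require Import Defs.
From HB Require Import structures.
From mathcomp Require Import all_boot all_order all_algebra.
From mathcomp Require Import complex zify ring.
From mathcomp Require Import all_classical all_reals all_analysis.
Set Implicit Arguments.
Unset Strict Implicit.
Unset Printing Implicit Defensive.
Import Order.TTheory GRing.Theory Num.Theory.
Import numFieldNormedType.Exports.
Local Open Scope classical_set_scope.
Local Open Scope ring_scope.

(** The two systems have the same matrix up to a scalar, so their normalized
    solutions should differ by a scalar function and by their Lambda factors.
    This is proved at each of the two singular points, and the scalars found
    there are the two halves of theta functions.

    At 0, write p = 1/q. The equations of the two systems give, for the
    holomorphic parts H0 and F0 of the normalized solutions, H0(p z) = N H0 B0^-1
    and F0(p z) = (1 - z) (1 - z/t) N F0 B0^-1. In an eigenbasis of B0 the entries
    x_ij of H0^-1 F0 therefore satisfy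
    (1 - z) (1 - z/t) x_ij(z) = d x_ij(p z) with d a quotient of two eigenvalues.
    Nonresonance modulo q^Z kills the off-diagonal entries, because a nonzero
    leading term x_k z^k would force d p^k = 1, and iteration of the equation
    gives x_ii = 1 / ((z; p)_oo (z/t; p)_oo). Hence
    (z; p)_oo (z/t; p)_oo F0 = H0, first near 0 and then everywhere, since the
    equations propagate the identity along the orbits of z |-> p z
    ([gauge_qpoch]). The same lemma in the coordinate 1/z, with the two systems
    exchanged, gives Foo = (p/z; p)_oo (p t/z; p)_oo Hoo.

    Substituting this in Q = Woo^-1 W0 leaves the quotients of Lambda matrices,
    which commute when they belong to the same singular point, being diagonal in
    one basis, and the scalar
    1 / ((z; p)_oo (p/z; p)_oo (z/t; p)_oo (p t/z; p)_oo). By the Jacobi triple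
    product ([jacobi_triple]) it is
    (p; p)_oo^2 / (Theta_q(-q z) Theta_q(-q z/t)). At infinity the Lambda matrices
    have the quotient q z^2 (I + (p-1) A2)^2 because
    Theta_q(q^2 x) = q x^2 Theta_q(x), which accounts for the constant q
    ([connection_formula]). The triple product is the limit of the finite
    q-binomial theorem; it also yields the functional equation of Theta_q and
    shows that its zeros are discrete in C^*, so that all divisions are legitimate
    off a discrete set.

    Replacing t by q t in the formula multiplies the scalar factor by -z/t and the
    last Lambda matrix by B0^-1 / (t z). As all other factors are invertible,
    Q(z, q t) = Q(z, t) means -t^-2 P(z, q t) B0^-1 = P(z, t)
    ([pseudo_constant_iff]).

    The exponent and leading matrix in the definition of a normalized solution
    are determined by the system ([leading_unique]). Solutions enter only through
    finite Taylor expansions at the singular point and continuity near it, the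
    class [regular] below. *)

(** * Geometric convergence in the complex numbers *)
Section CplxConvergence.
Variable R : realType.
Local Notation C := (Cplx R).
Definition toC (x : R) : C := Complex x 0.

Lemma pos_toC (e : C) : 0 <= e -> e = toC (complex.Re e).
Proof.
by case: e => a b; rewrite lecE /= => /andP[/eqP -> _].
Qed.

Lemma toC_lt (x y : R) : (toC x < toC y) = (x < y).
Proof. exact: ltcR. Qed.

Lemma toC_le (x y : R) : (toC x <= toC y) = (x <= y).
Proof. exact: lecR. Qed.

Lemma toCX (x : R) n : toC x ^+ n = toC (x ^+ n).
Proof. exact: (esym (rmorphXn (real_complex R) n x)). Qed.

Lemma toCM (x y : R) : toC x * toC y = toC (x * y).
Proof. exact: (esym (rmorphM (real_complex R) x y)). Qed.

Lemma cvg_expC (z : C) : `|z| < 1 -> (fun n : nat => z ^+ n) @ \oo --> (0 : C).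
Proof.
move=> z1; apply/cvgr0Pnorm_lt => e e0.
have ez := pos_toC (normr_ge0 z); have ee := pos_toC (ltW e0).
have r1 : `|complex.Re `|z| | < 1.
  move: z1; rewrite ez (_ : 1 = toC 1)// toC_lt => z1.
  rewrite ger0_norm//=; by rewrite -toC_le -ez normr_ge0.
have /cvgr0Pnorm_lt/(_ (complex.Re e)) := cvg_expr r1.
rewrite -toC_lt -ee => /(_ e0); apply: filterS => n.
rewrite -toC_lt -ee; apply: le_lt_trans.
by rewrite (normrX n z) ez toCX toC_le; apply: ler_norm.
Qed.

(** The real and the imaginary parts converge absolutely, by comparison with a
    real geometric series. *)
Lemma series_geoC_cvg (u : nat -> C) (K r : C) : 0 <= r < 1 ->
  (forall n, `|u n| <= K * r ^+ n) -> cvgn (series u).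
Proof.
move=> /andP[r0 r1] uK.
have K0 : 0 <= K by have := uK 0%N; rewrite expr0 mulr1; apply: le_trans.
have er := pos_toC r0; have eK := pos_toC K0.
set r' := complex.Re r in er; set K' := complex.Re K in eK.
have r'1 : `|r'| < 1.
  rewrite ger0_norm -?toC_le -?er//.
  by rewrite -toC_lt -er.
have dom (f : C -> R) : (forall z : C, toC `|f z| <= `|z|) ->
    cvgn (series (fun n => f (u n))).
  move=> fz; apply: (@normed_cvg R R^o).
  apply: (@series_le_cvg _ _ (geometric K' r')) => //=.
  - move=> n; apply: mulr_ge0; first by rewrite -toC_le -eK.
    by apply: exprn_ge0; rewrite -toC_le -er.
  - move=> n; rewrite -toC_le; apply: (le_trans (fz _)); apply: (le_trans (uK n)).
    by rewrite -toCM -toCX -er -eK.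
  - exact: is_cvg_geometric_series.
have fRe (z : C) : toC `|complex.Re z| <= `|z| by exact: normc_ge_Re.
have fIm (z : C) : toC `|complex.Im z| <= `|z|.
  case: z => a b; rewrite normc_def /= toC_le -sqrtr_sqr ler_sqrt ?addr_ge0 ?sqr_ge0//.
  by rewrite lerDr sqr_ge0.
have cRe := dom _ fRe; have cIm := dom _ fIm.
set a := limn (series (fun n => complex.Re (u n))) in cRe *.
set b := limn (series (fun n => complex.Im (u n))) in cIm *.
apply/cvg_ex; exists (Complex a b : C).
have su n : series u n = Complex (series (fun n => complex.Re (u n)) n)
   (series (fun n => complex.Im (u n)) n) :> C.
  elim: n => [|n IH]; first by rewrite /series /= !big_geq.
  by rewrite !seriesSr IH; case: (u n).
apply/cvgrPdist_lt => e e0.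
have ee := pos_toC (ltW e0); set e' := complex.Re e in ee.
have e'0 : 0 < e' / 2 by rewrite divr_gt0// -toC_lt -ee.
move/cvgrPdist_lt: cRe => /(_ _ e'0) cRe.
move/cvgrPdist_lt: cIm => /(_ _ e'0) cIm.
near=> n.
rewrite su ee.
have split_ReIm (x y x' y' : R) : (Complex x y : C) - Complex x' y' =
  toC (x - x') + toC (y - y') * Complex 0 1 by simpc.
rewrite split_ReIm.
apply: (le_lt_trans (ler_normD _ _)); rewrite normrM.
have -> : `|Complex 0 1 : C| = 1.
  by rewrite normc_def/= expr0n/= add0r expr1n sqrtr1.
have nC (x : R) : `|toC x| = toC `|x| by rewrite normc_def /= expr0n addr0 sqrtr_sqr.
rewrite mulr1 !nC (_ : e' = e' / 2 + e' / 2); last by rewrite -splitr.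
have -> : toC (e' / 2 + e' / 2) = toC (e' / 2) + toC (e' / 2) by simpc.
by apply: ltrD; rewrite toC_lt; near: n.
Unshelve. all: by end_near. Qed.

Lemma half_ratio : 0 <= (1/2 : C) < 1.
Proof. by rewrite divr_ge0//= ltr_pdivrMr// mul1r ltr1n. Qed.

End CplxConvergence.

(** * The infinite products (x; p)_oo *)
Section QPochhammer.
Variable R : realType.
Local Notation C := (Cplx R).

(** C is only partially ordered, so the total-order version of this principle
    does not apply; norms are comparable because they are nonnegative. *)
Lemma ler_addeps (x y : C) : 0 <= x -> 0 <= y ->
  (forall e, 0 < e -> x <= y + e) -> x <= y.
Proof.
move=> x0 y0 xy; rewrite real_leNgt ?ger0_real//; apply/negP => yx.
have d0 : 0 < (x - y) / 2 by rewrite divr_gt0 ?subr_gt0.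
have := xy _ d0; rewrite -lerBlDl; rewrite real_leNgt ?rpredB ?ger0_real// ?ltW//.
by rewrite gtr_pMr ?subr_gt0// invf_lt1 ?ltr1n.
Qed.

Lemma sum_geo_le (r : C) N m : 0 <= r < 1 -> \sum_(N <= n < m) r ^+ n <= r ^+ N / (1 - r).
Proof.
move=> /andP[r0 r1]; have s0 : 0 < 1 - r by rewrite subr_gt0.
have [mN|Nm] := leqP m N.
  by rewrite big_geq// divr_ge0 ?exprn_ge0// ltW.
rewrite ler_pdivlMr// mulrC.
have -> : (1 - r) * (\sum_(N <= n < m) r ^+ n) = r ^+ N - r ^+ m.
  rewrite big_distrr/= (eq_bigr (fun n => - (r ^+ n.+1 - r ^+ n))); last first.
    by move=> n _; rewrite mulrBl mul1r exprS opprB.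
  by rewrite sumrN telescope_sumr ?opprB// ltnW.
by rewrite lerBlDr lerDl exprn_ge0.
Qed.

Lemma series_geo_tail (u : nat -> C) (K r : C) N : 0 <= r < 1 ->
  (forall n, `|u n| <= K * r ^+ n) ->
  `|limn (series u) - series u N| <= K / (1 - r) * r ^+ N.
Proof.
move=> rr uK; have := series_geoC_cvg rr uK; case/andP: (rr) => r0 r1.
have s0 : 0 < 1 - r by rewrite subr_gt0.
have K0 : 0 <= K by have := uK 0%N; rewrite expr0 mulr1; apply: le_trans.
move/cvgrPdist_le => uc.
apply: ler_addeps => // [|e e0].
  by rewrite !mulr_ge0 ?invr_ge0 ?exprn_ge0// ltW.
have [M _ /(_ (maxn M N))] := uc _ e0.
rewrite /= leq_maxl => /(_ isT).
have -> : limn (series u) - series u N =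
    (series u (maxn M N) - series u N) + (limn (series u) - series u (maxn M N)).
  by rewrite [RHS]addrC subrKA.
move=> h; apply: (le_trans (ler_normD _ _)); apply: lerD => //.
rewrite sub_series_geq ?leq_maxr//; apply: (le_trans (ler_norm_sum _ _ _)).
apply: (@le_trans _ _ (\sum_(N <= k < maxn M N) K * r ^+ k)); first exact: ler_sum.
by rewrite -big_distrr/= mulrAC -mulrA ler_wpM2l// sum_geo_le.
Qed.

Variable p : C.
Hypothesis p1 : `|p| < 1.

(** [qpoch x] is the q-Pochhammer symbol (x; p)_oo. *)
Definition qpoch_part (x : C) N := \prod_(0 <= n < N) (1 - p ^+ n * x).
Definition qpoch (x : C) : C := limn (qpoch_part x).

Lemma qpoch_partS x N : qpoch_part x N.+1 = (1 - x) * qpoch_part (p * x) N.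
Proof.
rewrite /qpoch_part big_nat_recl// expr0 mul1r; congr (_ * _).
by apply: eq_bigr => n _; rewrite exprSr mulrA.
Qed.

Let pp : 0 <= `|p| < 1. Proof. by rewrite normr_ge0. Qed.
Let s0 : 0 < 1 - `|p|. Proof. by rewrite subr_gt0. Qed.

(** By induction, each partial product differs from 1 by at most
    2 |x| (1 + |p| + ... + |p|^(N-1)): as long as this is at most 1/2 the partial
    products stay below 2, which controls the next increment. *)
Lemma qpoch_part_small x N : `|x| <= (1 - `|p|) / 4 -> `|qpoch_part x N - 1| <= 2^-1.
Proof.
move=> xs.
suff h : forall N, `|qpoch_part x N - 1| <= 2 * `|x| * \sum_(0 <= n < N) `|p| ^+ n /\
    2 * `|x| * \sum_(0 <= n < N) `|p| ^+ n <= 2^-1.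
  by case: (h N) => h1 h2; apply: le_trans h2.
(* The threshold (1 - |p|) / 4 is what makes this bound at most 1/2. *)
have b M : 2 * `|x| * \sum_(0 <= n < M) `|p| ^+ n <= 2^-1.
  have := sum_geo_le 0 M pp; rewrite expr0 div1r => h.
  apply: (@le_trans _ _ (2 * ((1 - `|p|) / 4) * (1 - `|p|)^-1)).
    apply: ler_pM; rewrite ?mulr_ge0 //.
      by apply: sumr_ge0 => i _; apply: exprn_ge0.
    by rewrite ler_wpM2l.
  rewrite [leLHS](_ : _ = 2^-1) //; field.
  by rewrite gt_eqF.
elim => [|n [IH _]]; first by rewrite /qpoch_part !big_geq// subrr normr0 mulr0.
split=> //.
have P2 : `|qpoch_part x n| <= 2.
  rewrite -[qpoch_part x n](subrK 1); apply: (le_trans (ler_normD _ _)).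
  rewrite normr1 (natrD _ 1 1) lerD2r; apply: (le_trans IH); apply: (le_trans (b n)).
  by rewrite invf_le1 ?ler1n.
rewrite big_nat_recr//= /qpoch_part big_nat_recr//= -/(qpoch_part x n) mulrBr mulr1 addrAC.
apply: (le_trans (ler_normB _ _)); rewrite mulrDr lerD// !normrM normrX.
rewrite (_ : 2 * `|x| * `|p| ^+ n = 2 * (`|p| ^+ n * `|x|)); last by ring.
by apply: ler_wpM2r => //; rewrite mulr_ge0 ?exprn_ge0.
Qed.

(** The increments of the partial products are geometrically small. *)
Lemma qpoch_cvg_small x : `|x| <= (1 - `|p|) / 4 -> cvgn (qpoch_part x).
Proof.
move=> xs.
have -> : qpoch_part x = (fun n => 1 + series (fun n => qpoch_part x n.+1 - qpoch_part x n) n).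
  apply/funext => n; rewrite /series/= telescope_sumr//.
  by rewrite [X in _ - X]/qpoch_part big_geq// subrKC.
apply: is_cvgD; first exact: is_cvg_cst.
apply: (@series_geoC_cvg _ _ (`|x| * 2) `|p|) => // n.
rewrite {1}/qpoch_part big_nat_recr//= -/(qpoch_part x n) mulrBr mulr1 addrAC subrr add0r.
rewrite normrN !normrM normrX.
rewrite (_ : `|x| * 2 * `|p| ^+ n = 2 * (`|p| ^+ n * `|x|)); last by ring.
apply: ler_wpM2r; first by rewrite mulr_ge0 ?exprn_ge0.
rewrite -[qpoch_part x n](subrK 1); apply: (le_trans (ler_normD _ _)).
rewrite normr1 (natrD _ 1 1) lerD2r; apply: (le_trans (qpoch_part_small n xs)).
by rewrite invf_le1 ?ler1n.
Qed.

Lemma exists_exp_small (x e : C) : 0 < e -> exists n, `|p ^+ n * x| <= e.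
Proof.
move=> e0; have /cvgr0Pnorm_le := cvg_expC p1.
have [->|x0] := eqVneq x 0; first by exists 0%N; rewrite mulr0 normr0 ltW.
have h : 0 < e / `|x| by rewrite divr_gt0 ?normr_gt0.
move=> /(_ _ h)[n _ /(_ n)] /= /(_ (leqnn n)) hn; exists n.
by rewrite normrM -ler_pdivlMr ?normr_gt0.
Qed.

Let small_pos : 0 < (1 - `|p|) / 4. Proof. by rewrite divr_gt0. Qed.

(** The factors 1 - p^k x with p^k x not small are finitely many and can be
    split off one at a time. *)
Lemma qpoch_part_is_cvg x : cvgn (qpoch_part x).
Proof.
have [n] := exists_exp_small x small_pos.
elim: n x => [|n IH] x; first by rewrite mul1r; exact: qpoch_cvg_small.
rewrite exprSr -mulrA => /IH h.
apply/cvg_ex; exists (limn (fun n => qpoch_part x n.+1)); rewrite -cvg_shiftS.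
suff : cvgn (fun n => qpoch_part x n.+1) by [].
have -> : (fun n => qpoch_part x n.+1) = (fun n => (1 - x) * qpoch_part (p * x) n).
  by apply/funext => k; exact: qpoch_partS.
apply: cvgP; apply: cvgM; [exact: cvg_cst|exact: h].
Qed.

Lemma qpoch_cvg x : qpoch_part x @ \oo --> qpoch x.
Proof. exact: qpoch_part_is_cvg. Qed.

Lemma qpoch_rec x : qpoch x = (1 - x) * qpoch (p * x).
Proof.
apply: (@cvg_lim C) => //; rewrite -cvg_shiftS.
have -> : (fun n => qpoch_part x n.+1) = (fun n => (1 - x) * qpoch_part (p * x) n).
  by apply/funext => k; exact: qpoch_partS.
by apply: cvgM; [exact: cvg_cst|exact: qpoch_cvg].
Qed.

(** If x is small the product is within 1/2 of 1; in general one peels off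
    factors with [qpoch_rec], one of which must vanish. *)
Lemma qpoch_eq0 x : qpoch x = 0 -> exists n, p ^+ n * x = 1.
Proof.
have [n] := exists_exp_small x small_pos.
elim: n x => [|n IH] x.
  rewrite mul1r => xs q0; exfalso.
  have h : 0 < 1 / 2 :> C by rewrite divr_gt0.
  have /cvgrPdist_lt/(_ _ h)[N _ /(_ N)/=/(_ (leqnn N))] := qpoch_cvg (x:=x).
  rewrite q0 sub0r normrN => hN.
  have := qpoch_part_small N xs => hN2.
  have : `|1 : C| < 1.
    rewrite -{1}(subrKC (qpoch_part x N) 1); apply: (le_lt_trans (ler_normD _ _)).
    rewrite [X in _ < X](_ : 1 = 1/2 + 2^-1); last by field.
    by apply: ltr_leD => //; rewrite distrC.
  by rewrite normr1 ltxx.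
rewrite exprSr -mulrA => /IH h; rewrite qpoch_rec => /eqP; rewrite mulf_eq0 => /orP[|/eqP/h[k hk]].
  by rewrite subr_eq0 => /eqP <-; exists 0%N; rewrite mul1r.
by exists k.+1; rewrite exprSr -mulrA.
Qed.

Lemma qpoch1 : qpoch 1 = 0.
Proof. by rewrite qpoch_rec subrr mul0r. Qed.

End QPochhammer.

(** * The finite q-binomial theorem *)
Section GaussBinomial.
Variables (K : fieldType) (p : K).

(** Gaussian binomial coefficients, by the q-Pascal rule. *)
Fixpoint gauss_bin N j : K :=
  match N, j with
  | _, 0 => 1
  | 0, _.+1 => 0
  | N'.+1, j'.+1 => gauss_bin N' j'.+1 + p ^+ (N' - j') * gauss_bin N' j'
  end.

Lemma gauss_binS N j :
  gauss_bin N.+1 j.+1 = gauss_bin N j.+1 + p ^+ (N - j) * gauss_bin N j.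
Proof. by []. Qed.

Lemma gauss_bin0 N : gauss_bin N 0 = 1. Proof. by case: N. Qed.

Lemma gauss_bin_small N j : (N < j)%N -> gauss_bin N j = 0.
Proof.
elim: N j => [|N IH] [|j]//; rewrite ltnS gauss_binS => Nj.
by rewrite !IH ?mulr0 ?addr0// ltnW.
Qed.

Definition qfact N : K := \prod_(0 <= n < N) (1 - p ^+ n.+1).

Lemma qfactS N : qfact N.+1 = qfact N * (1 - p ^+ N.+1).
Proof. by rewrite /qfact big_nat_recr. Qed.

Lemma gauss_bin_qfact N j : (j <= N)%N ->
  gauss_bin N j * qfact j * qfact (N - j) = qfact N.
Proof.
have q0 : qfact 0 = 1 by rewrite /qfact big_geq.
elim: N j => [|N IH] [|j]; rewrite ?gauss_bin0 ?q0 ?subn0 ?mul1r ?mulr1//.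
rewrite ltnS subSS => jN; rewrite gauss_binS 2!mulrDl.
have -> : p ^+ (N - j) * gauss_bin N j * qfact j.+1 * qfact (N - j) = p ^+ (N - j) * (1 - p ^+ j.+1) * qfact N.
  by rewrite qfactS -(IH _ jN); ring.
have -> : gauss_bin N j.+1 * qfact j.+1 * qfact (N - j) = (1 - p ^+ (N - j)) * qfact N.
  move: jN; rewrite leq_eqVlt => /orP[/eqP->|jN].
    by rewrite gauss_bin_small// subnn expr0 subrr !mul0r.
  by rewrite -(IH _ jN) -(subnSK jN) (qfactS (N - j.+1)); ring.
rewrite qfactS -mulrDl mulrC; congr (_ * _).
by rewrite -[in RHS](subnK jN) -addnS exprD; ring.
Qed.

(** The q-Pascal rule is exactly the recursion obtained by multiplying the
    product by its next factor 1 + p^N x. *)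
Lemma qbinomial x N : \prod_(0 <= k < N) (1 + p ^+ k * x) =
  \sum_(0 <= j < N.+1) p ^+ 'C(j, 2) * gauss_bin N j * x ^+ j.
Proof.
elim: N => [|N IH].
  by rewrite big_geq// big_nat1 gauss_bin0 !mul1r.
rewrite big_nat_recr//= IH mulrDr mulr1 [RHS]big_nat_recl//.
rewrite [in RHS](eq_bigr (fun j => p ^+ 'C(j.+1, 2) * gauss_bin N j.+1 * x ^+ j.+1 +
   p ^+ 'C(j, 2) * p ^+ j * p ^+ (N - j) * gauss_bin N j * x ^+ j.+1)); last first.
  by move=> j _; rewrite binS bin1 exprD; ring.
rewrite big_split/= addrA; congr (_ + _).
  rewrite [in RHS]big_nat_recr//= gauss_bin_small// mulr0 mul0r addr0.
  by rewrite [LHS]big_nat_recl// !gauss_bin0.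
rewrite big_distrl/=; apply: eq_big_nat => j /andP[_]; rewrite ltnS => jN.
rewrite (_ : p ^+ N = p ^+ j * p ^+ (N - j)); last by rewrite -exprD subnKC.
by rewrite exprS; ring.
Qed.

End GaussBinomial.

(** * The Jacobi triple product *)
(** The q-binomial theorem for 2m factors at x = p^(1-m) z: the factors with
    k >= m are the 1 + p^i z with 1 <= i <= m, and those with k < m become
    1 + p^i / z after extraction of z / p^i. The index n = j - m of the
    right-hand side is split according to its sign. *)
Lemma jacobi_finite (K : fieldType) (p z : K) m : p != 0 -> z != 0 ->
  (\prod_(0 <= n < m) (1 - p ^+ n * - (p * z))) *
  (\prod_(0 <= n < m) (1 - p ^+ n * - z^-1)) =
  \sum_(0 <= n < m.+1) gauss_bin p (m + m) (m + n) * (p ^+ 'C(n.+1, 2) * z ^+ n) +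
  \sum_(0 <= n < m) gauss_bin p (m + m) (m - n.+1) * (p ^+ 'C(n.+1, 2) * z ^- n.+1).
Proof.
move=> p0 z0.
have pm0 n : p ^+ n != 0 by rewrite expf_neq0.
have zm0 n : z ^+ n != 0 by rewrite expf_neq0.
have binD a b : 'C(a + b, 2) = ('C(a, 2) + 'C(b, 2) + a * b)%N.
  elim: a => [|a IH]; first by rewrite add0n mul0n addn0.
  by rewrite addSn !binS !bin1 IH; lia.
have bin_sq a : ('C(a, 2) + 'C(a, 2) + a = a * a)%N.
  by elim: a => [|a IH]; [|rewrite !binS !bin1; lia].
pose x := p * z / p ^+ m.
have hc : \prod_(0 <= k < m + m) (1 + p ^+ k * x) =
   (\prod_(0 <= i < m) (z / p ^+ i)) *
   ((\prod_(0 <= n < m) (1 - p ^+ n * - (p * z))) *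
   (\prod_(0 <= n < m) (1 - p ^+ n * - z^-1))).
  rewrite (big_cat_nat (leq0n m) (leq_addr m m))/= [RHS]mulrCA [LHS]mulrC; congr (_ * _).
    rewrite -{1}[m]add0n big_addn addnK; apply: eq_bigr => i _.
    by rewrite /x exprD; field.
  rewrite big_nat_rev/= -big_split/=; apply: eq_big_nat => i /andP[_ im].
  rewrite add0n /x (_ : p ^+ m = p ^+ (m - i.+1) * p ^+ i.+1); last by rewrite -exprD subnK.
  by rewrite exprS; field; rewrite z0 p0 !pm0.
have pc k : \prod_(0 <= i < k) (z / p ^+ i) = z ^+ k / p ^+ 'C(k, 2).
  elim: k => [|k IH]; first by rewrite big_geq// !expr0 divr1.
  by rewrite big_nat_recr//= IH binS bin1 exprD exprS; field; rewrite !pm0.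
have c0 : z ^+ m / p ^+ 'C(m, 2) != 0 by rewrite mulf_neq0 ?invr_eq0.
apply: (mulfI c0); rewrite -{1}pc -hc qbinomial.
rewrite (big_cat_nat (leq0n m) (leqW (leq_addr m m)))/= addrC mulrDr; congr (_ + _).
  rewrite -{1}[m]add0n big_addn -addnS addKn big_distrr/=; apply: eq_bigr => n _.
  rewrite addnC /x !exprMn exprVn.
  have e : p ^+ 'C(m + n, 2) * p ^+ (m + n) * p ^+ 'C(m, 2) = p ^+ 'C(n.+1, 2) * p ^+ m ^+ (m + n).
    rewrite -exprM -!exprD; congr (_ ^+ _); rewrite binS bin1 binD.
    have := bin_sq m; nia.
  have -> : p ^+ 'C(m + n, 2) = p ^+ 'C(n.+1, 2) * p ^+ m ^+ (m + n) / (p ^+ (m + n) * p ^+ 'C(m, 2)).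
    by rewrite -e; field; rewrite !pm0.
  by rewrite (exprD z); field; rewrite !pm0 expf_neq0.
rewrite big_nat_rev/= big_distrr/=; apply: eq_big_nat => n /andP[_ nm].
rewrite add0n /x !exprMn exprVn; set j := (m - n.+1)%N.
have mE : m = (j + n.+1)%N by rewrite subnK.
have e : p ^+ 'C(j, 2) * p ^+ j * p ^+ 'C(m, 2) = p ^+ 'C(n.+1, 2) * p ^+ m ^+ j.
  rewrite -exprM -!exprD; congr (_ ^+ _); rewrite mE binD.
  have := bin_sq j; nia.
have -> : p ^+ 'C(j, 2) = p ^+ 'C(n.+1, 2) * p ^+ m ^+ j / (p ^+ j * p ^+ 'C(m, 2)).
  by rewrite -e; field; rewrite !pm0.
rewrite (_ : z ^+ m = z ^+ j * z ^+ n.+1); last by rewrite -exprD -mE.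
by field; rewrite ?zm0 ?pm0 ?expf_neq0 ?pm0 ?z0.
Qed.

Section Theta.
Variable R : realType.
Local Notation C := (Cplx R).

(** Dominated convergence for series: a geometric bound, uniform in m, makes the
    tails negligible, and a finite sum passes to the limit. *)
Lemma tannery (a : nat -> nat -> C) (b : nat -> C) (f : nat -> nat) (K r : C) :
  0 <= r < 1 -> (forall m, (m <= f m)%N) ->
  (forall m n, `|a m n| <= K * r ^+ n) ->
  (forall n, (fun m => a m n) @ \oo --> b n) ->
  (fun m => \sum_(0 <= n < f m) a m n) @ \oo --> limn (series b).
Proof.
move=> rr fm aK ab; case/andP: (rr) => r0 r1.
have s0 : 0 < 1 - r by rewrite subr_gt0.
have K0 : 0 <= K by have := aK 0%N 0%N; rewrite expr0 mulr1; apply: le_trans.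
have bK n : `|b n| <= K * r ^+ n.
  apply: ler_addeps => // [|e e0]; first by rewrite mulr_ge0 ?exprn_ge0.
  move/cvgrPdist_le: (ab n) => /(_ _ e0)[N _ /(_ N)/=/(_ (leqnn N)) h].
  by rewrite -[b n](subrKC (a N n)); apply: (le_trans (ler_normD _ _)); apply: lerD.
apply/cvgrPdist_lt => e e0.
have e3 : 0 < e / 3 by rewrite divr_gt0.
have [M hM] : exists M, `|r ^+ M * (K / (1 - r))| <= e / 3.
  by apply: exists_exp_small => //; rewrite ger0_norm.
rewrite ger0_norm ?mulr_ge0 ?exprn_ge0 ?invr_ge0 ?(ltW s0)// in hM.
have hs : (fun m => \sum_(0 <= n < M) a m n) @ \oo --> \sum_(0 <= n < M) b n.
  elim: M {hM} => [|M IH].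
    have -> : (fun m => \sum_(0 <= n < 0) a m n) = (fun=> 0) by apply/funext => m; rewrite big_geq.
    have -> : \sum_(0 <= n < 0) b n = 0 by rewrite big_geq.
    exact: cvg_cst.
  have -> : (fun m => \sum_(0 <= n < M.+1) a m n) = (fun m => \sum_(0 <= n < M) a m n) + a^~ M.
    by apply/funext => m; rewrite big_nat_recr.
  have -> : \sum_(0 <= n < M.+1) b n = \sum_(0 <= n < M) b n + b M by rewrite big_nat_recr.
  exact: (cvgD IH (ab M)).
move/cvgrPdist_lt: hs => /(_ _ e3) hs.
near=> m.
have Mm : (M <= m)%N by near: m; exact: nbhs_infty_ge.
have Mf := leq_trans Mm (fm m).
rewrite (big_cat_nat (leq0n M) Mf)/=.
have -> : limn (series b) - (\sum_(0 <= n < M) a m n + \sum_(M <= n < f m) a m n) =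
  (limn (series b) - series b M) + (\sum_(0 <= n < M) b n - \sum_(0 <= n < M) a m n) - \sum_(M <= n < f m) a m n.
  rewrite /series/=; ring.
apply: (le_lt_trans (ler_normB _ _)).
rewrite (_ : e = e / 3 + e / 3 + e / 3); last by field.
apply: ltr_leD.
  apply: (le_lt_trans (ler_normD _ _)); apply: ler_ltD.
    by apply: (le_trans (series_geo_tail M rr bK)); rewrite mulrC.
  by near: m.
apply: le_trans hM; apply: (le_trans (ler_norm_sum _ _ _)).
apply: (@le_trans _ _ (\sum_(M <= k < f m) K * r ^+ k)); first exact: ler_sum.
rewrite -big_distrr/= mulrCA ler_wpM2l//; exact: sum_geo_le.
Unshelve. all: by end_near. Qed.

(** The ratio test; the constant absorbs the first n0 terms. *)
Lemma geo_ratio_bound (u : nat -> C) (r : C) n0 : 0 < r ->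
  (forall n, (n0 <= n)%N -> `|u n.+1| <= r * `|u n|) ->
  exists K, forall n, `|u n| <= K * r ^+ n.
Proof.
move=> r0 hu; pose K := \sum_(0 <= k < n0.+1) `|u k| / r ^+ k; exists K.
have le0 n : (n <= n0)%N -> `|u n| <= K * r ^+ n.
  move=> nn; rewrite -ler_pdivrMr ?exprn_gt0// /K (bigD1_seq n) ?iota_uniq//=; last first.
    by rewrite mem_index_iota ltnS.
  rewrite lerDl; apply: sumr_ge0 => k _; apply: divr_ge0 => //.
  by apply: exprn_ge0; apply: ltW.
elim=> [|n IH]; first exact: le0.
have [nn|nn] := leqP n.+1 n0; first exact: le0.
apply: (le_trans (hu n _)) => //.
by rewrite exprS mulrCA ler_wpM2l// ltW.
Qed.

Variable p : C.
Hypothesis p1 : `|p| < 1.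
Hypothesis p0 : p != 0.

(** The ratio of consecutive terms is p^(n+1) z, which tends to 0. *)
Lemma theta_term_bound (z : C) : exists K, forall n, `|p ^+ 'C(n.+1, 2) * z ^+ n| <= K * (1/2) ^+ n.
Proof.
have h : 0 < 1/2 :> C by rewrite divr_gt0.
have [n0 hn0] := exists_exp_small p1 z h.
apply: (@geo_ratio_bound _ _ n0) => // n nn.
have -> : p ^+ 'C(n.+2, 2) * z ^+ n.+1 = (p ^+ (n.+1 - n0) * (p ^+ n0 * z)) * (p ^+ 'C(n.+1, 2) * z ^+ n).
  rewrite (binS n.+1 1) bin1 exprD (exprS z).
  rewrite (_ : p ^+ n.+1 = p ^+ (n.+1 - n0) * p ^+ n0); first by ring.
  by rewrite -exprD subnK// leqW.
rewrite normrM ler_wpM2r// normrM; apply: le_trans hn0; rewrite ler_piMl//.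
by rewrite normrX; apply: exprn_ile1 => //; apply: ltW.
Qed.

Lemma qpoch_part_p N : qpoch_part p p N = qfact p N.
Proof. by apply: eq_bigr => n _; rewrite exprSr. Qed.

Lemma expr_neq1 n : p ^+ n.+1 != 1.
Proof.
apply/eqP => /(congr1 Num.norm); rewrite normrX normr1 => h.
have : `|p| ^+ n.+1 < 1 by rewrite exprn_ilt1.
by rewrite h ltxx.
Qed.

Lemma qfact_neq0 N : qfact p N != 0.
Proof.
elim: N => [|N IH]; first by rewrite /qfact big_geq// oner_eq0.
by rewrite qfactS mulf_neq0// subr_eq0 eq_sym expr_neq1.
Qed.

Lemma qpoch_p_neq0 : qpoch p p != 0.
Proof. by apply/eqP => /(qpoch_eq0 p1)[n]; rewrite -exprSr; apply/eqP/expr_neq1. Qed.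

Lemma qfact_cvg : qfact p @ \oo --> qpoch p p.
Proof.
have -> : qfact p = qpoch_part p p by apply/funext => N; rewrite qpoch_part_p.
exact: qpoch_cvg.
Qed.

Lemma cvg_norm_bounded (u : nat -> C) (l : C) : u @ \oo --> l -> exists2 K, 0 <= K & forall n, `|u n| <= K.
Proof.
move=> /cvgrPdist_le /(_ 1 ltr01)[N _ hN].
exists (\sum_(0 <= k < N) `|u k| + (`|l| + 1)).
  by rewrite addr_ge0// ?addr_ge0//; apply: sumr_ge0.
move=> n; have [nN|Nn] := ltnP n N.
  rewrite (bigD1_seq n) ?iota_uniq//= ?mem_index_iota// -addrA lerDl.
  by rewrite !addr_ge0//; apply: sumr_ge0.
apply: ler_wpDl; first by apply: sumr_ge0.
rewrite -[u n](subKr l); apply: (le_trans (ler_normB _ _)).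
by rewrite lerD2l; exact: hN.
Qed.

(** The Gaussian binomial is a quotient of factorials (p; p)_N, which converge to
    a nonzero limit and are therefore bounded above and away from 0. *)
Lemma gauss_bin_bound : exists2 K, 0 <= K & forall N j, `|gauss_bin p N j| <= K.
Proof.
have [A A0 hA] := cvg_norm_bounded qfact_cvg.
have [B B0 hB] := cvg_norm_bounded (cvgV qpoch_p_neq0 qfact_cvg).
exists (A * B * B); first by rewrite !mulr_ge0.
move=> N j; have [jN|Nj] := leqP j N; last by rewrite gauss_bin_small// normr0 !mulr_ge0.
have -> : gauss_bin p N j = qfact p N * (qfact p j)^-1 * (qfact p (N - j))^-1.
  by rewrite -(gauss_bin_qfact p jN); field; rewrite !qfact_neq0.
rewrite 2!normrM; apply: ler_pM; rewrite ?mulr_ge0//; last exact: hB.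
by apply: ler_pM => //; exact: hB.
Qed.

(** The limit 1 / (p; p)_oo of the central Gaussian binomials is where the
    constant (p; p)_oo of the triple product comes from. *)
Lemma gauss_bin_cvg (f : nat -> nat) : (f m @[m --> \oo] --> \oo) -> ((m + m - f m)%N @[m --> \oo] --> \oo) ->
  (\forall m \near \oo, (f m <= m + m)%N) ->
  (fun m => qpoch p p * gauss_bin p (m + m) (f m)) @ \oo --> (1 : C).
Proof.
move=> f1 f2 fm.
have mm : (m + m)%N @[m --> \oo] --> \oo.
  by move=> P [N _ PN]; exists N => // k /= Nk; apply: PN; rewrite /= (leq_trans Nk)// leq_addr.
have h : (fun m => qpoch p p * (qfact p (m + m) * (qfact p (f m))^-1 * (qfact p (m + m - f m))^-1)) @ \oo -->
   qpoch p p * (qpoch p p * (qpoch p p)^-1 * (qpoch p p)^-1).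
  apply: cvgM; first exact: cvg_cst.
  apply: cvgM; [apply: cvgM|]; [|apply: cvgV|apply: cvgV]; rewrite ?qpoch_p_neq0//.
  - exact: (cvg_comp _ _ mm qfact_cvg).
  - exact: (cvg_comp _ _ f1 qfact_cvg).
  - exact: (cvg_comp _ _ f2 qfact_cvg).
rewrite (_ : 1 = qpoch p p * (qpoch p p * (qpoch p p)^-1 * (qpoch p p)^-1)); last first.
  by field; rewrite qpoch_p_neq0.
apply: cvg_trans h; apply: near_eq_cvg; move: fm; apply: filterS => m fm.
congr (_ * _); rewrite -(gauss_bin_qfact p fm); field; by rewrite !qfact_neq0.
Qed.

Lemma Theta_termE (z : C) : z != 0 -> let u := fun n => p^-1 ^ (- ((n * (n + 1)) %/ 2)%Z) * z ^ n in
  (forall n : nat, u (Posz n) = p ^+ 'C(n.+1, 2) * z ^+ n) /\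
  (forall n : nat, u (Negz n) = p ^+ 'C(n.+1, 2) * z ^- n.+1).
Proof.
move=> z0 u.
have pp n' : p^-1 ^ (- Posz n') = p ^+ n' by rewrite exprz_inv opprK.
split=> k; rewrite /u.
  have -> : ((Posz k * (Posz k + 1)) %/ 2)%Z = Posz 'C(k.+1, 2).
    by rewrite bin2 /= -divn2 -divz_nat; congr (_ %/ _)%Z; lia.
  by rewrite pp.
have -> : ((Negz k * (Negz k + 1)) %/ 2)%Z = Posz 'C(k.+1, 2).
  by rewrite bin2 /= -divn2 -divz_nat NegzE; congr (_ %/ _)%Z; lia.
by rewrite pp.
Qed.

(** The limit m -> oo of [jacobi_finite], taken termwise with [tannery]. *)
Lemma jacobi_triple z : z != 0 ->
  Theta p^-1 z = qpoch p p * qpoch p (- (p * z)) * qpoch p (- z^-1).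
Proof.
move=> z0.
have h2 := half_ratio R.
have [G G0 hG] := gauss_bin_bound.
have [K1 hK1] := theta_term_bound z.
have [K2 hK2] := theta_term_bound z^-1.
rewrite /Theta /bilateral_sum.
have [uP uN] := Theta_termE z0.
rewrite (_ : (fun n : nat => _) = (fun n => p ^+ 'C(n.+1, 2) * z ^+ n)); last by apply/funext => n; exact: uP.
rewrite [X in _ + limn (series X)](_ : _ = (fun n => p ^+ 'C(n.+1, 2) * z ^- n.+1));
  last by apply/funext => n; exact: uN.
set b1 := fun n => _; set b2 := fun n => p ^+ _ * z ^- _.
have c1 : (fun m => \sum_(0 <= n < m.+1)
    qpoch p p * gauss_bin p (m + m) (m + n) * b1 n) @ \oo --> limn (series b1).
  apply: (@tannery (fun m n => qpoch p p * gauss_bin p (m + m) (m + n) * b1 n)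
    b1 succn (`|qpoch p p| * G * K1) (1/2) h2 _ _ _) => [m|m n|n]; first exact: leqnSn.
    rewrite 2!normrM -!mulrA ler_wpM2l//; apply: ler_pM => //; exact: hK1.
  rewrite -[X in _ --> X]mul1r; apply: cvgM; last exact: cvg_cst.
  apply: gauss_bin_cvg.
  - move=> P [N _ PN]; exists N => // k /= Nk; apply: PN; rewrite /= (leq_trans Nk)// leq_addr//.
  - move=> P [N _ PN]; exists (N + n)%N => // k /= Nk; apply: PN; rewrite /=; lia.
  - by exists n => // k /= nk; lia.
have c2 : (fun m => \sum_(0 <= n < m)
    qpoch p p * gauss_bin p (m + m) (m - n.+1) * b2 n) @ \oo --> limn (series b2).
  apply: (@tannery (fun m n => qpoch p p * gauss_bin p (m + m) (m - n.+1) * b2 n)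
    b2 id (`|qpoch p p| * G * (K2 * `|z^-1|)) (1/2) h2 _ _ _) => [m|m n|n]; first by [].
    rewrite 2!normrM -!mulrA ler_wpM2l//; apply: ler_pM => //.
    rewrite /b2 exprSr invfM mulrA mulrA normrM -[z ^- n]exprVn mulrAC ler_wpM2r//; exact: hK2.
  rewrite -[X in _ --> X]mul1r; apply: cvgM; last exact: cvg_cst.
  apply: gauss_bin_cvg.
  - move=> P [N _ PN]; exists (N + n.+1)%N => // k /= Nk; apply: PN; rewrite /=; lia.
  - move=> P [N _ PN]; exists N => // k /= Nk; apply: PN; rewrite /=; lia.
  - by exists 0%N => // k /= nk; lia.
pose F m := qpoch p p * (qpoch_part p (- (p * z)) m * qpoch_part p (- z^-1) m).
have F1 : F @ \oo --> limn (series b1) + limn (series b2).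
  have -> : F = (fun m => \sum_(0 <= n < m.+1) qpoch p p * gauss_bin p (m + m) (m + n) * b1 n) +
      (fun m => \sum_(0 <= n < m) qpoch p p * gauss_bin p (m + m) (m - n.+1) * b2 n).
    apply/funext => m; rewrite /F /qpoch_part jacobi_finite// mulrDr !big_distrr/=.
    by congr (_ + _); apply: eq_bigr => i _; exact: mulrA.
  exact: (cvgD c1 c2).
have F2 : F @ \oo --> qpoch p p * (qpoch p (- (p * z)) * qpoch p (- z^-1)).
  apply: cvgM; first exact: cvg_cst.
  by apply: cvgM; exact: qpoch_cvg.
by rewrite -(norm_cvg_lim F1) (norm_cvg_lim F2) mulrA.
Qed.

(** In the product formula, z |-> z / p trades the factor 1 + 1/z for 1 + z. At
    z = -1, where that exchange divides by 0, both sides vanish. *)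
Lemma Theta_qshift z : z != 0 -> Theta p^-1 (p^-1 * z) = z * Theta p^-1 z.
Proof.
move=> z0; have pV0 : p^-1 != 0 by rewrite invr_eq0.
rewrite !jacobi_triple ?mulf_neq0//.
have -> : p * (p^-1 * z) = z by field.
have -> : - (p^-1 * z)^-1 = p * - z^-1 by field; rewrite z0 p0.
have [->|z1] := eqVneq z (-1).
  rewrite invrN invr1 !opprK (qpoch1 p1); ring.
rewrite (qpoch_rec p1 (- z)) (qpoch_rec p1 (- z^-1)) mulrN; field.
by rewrite z0.
Qed.

Lemma Theta_eq0 z : z != 0 -> Theta p^-1 z = 0 -> exists n : int, z = - p ^ n.
Proof.
move=> z0; rewrite jacobi_triple// => /eqP; rewrite !mulf_eq0 (negPf qpoch_p_neq0)/=.
case/orP => /eqP/(qpoch_eq0 p1)[n].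
  rewrite mulrN mulrA -exprSr => e; exists (- Posz n.+1).
  rewrite -exprnN; apply: (mulfI (_ : - p ^+ n.+1 != 0)); rewrite ?oppr_eq0 ?expf_neq0//.
  by rewrite mulNr e mulrNN divff ?expf_neq0.
move=> e; exists (Posz n); rewrite -exprnP.
by rewrite -[z]mul1r -e mulrN mulNr mulfVK.
Qed.

End Theta.

(** * Functions with Taylor expansions of every order at the origin *)
Section Taylor.
Variable R : realType.
Local Notation C := (Cplx R).
Implicit Types f g : C -> C.

Lemma near_all (c : C) (P : C -> Prop) : (forall z, P z) -> \forall z \near c, P z.
Proof. by move=> h; near=> z; exact: h.
Unshelve. all: by end_near. Qed.

Lemma near_imply (c : C) (P S : C -> Prop) : (forall z, P z -> S z) ->
  (\forall z \near c, P z) -> \forall z \near c, S z.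
Proof. by move=> PS; apply: filterS. Qed.

Lemma near_imply2 (c : C) (P Q S : C -> Prop) : (forall z, P z -> Q z -> S z) ->
  (\forall z \near c, P z) -> (\forall z \near c, Q z) -> \forall z \near c, S z.
Proof. by move=> PQS; apply: filterS2. Qed.

Lemma cvg_atP f (c l : C) : f @ c --> l <->
  forall e : C, 0 < e -> \forall z \near c, `|l - f z| <= e.
Proof. exact: (@cvgrPdist_le C C C (nbhs c)). Qed.

Lemma cvg_at_ext f g (c l : C) : (\forall z \near c, f z = g z) ->
  f @ c --> l -> g @ c --> l.
Proof.
move=> fg /cvg_atP fl; apply/cvg_atP => e e0; have := fl e e0 => fe.
near=> z; rewrite -(_ : f z = g z); near: z; [exact: fe|exact: fg].
Unshelve. all: by end_near. Qed.

(** Finite Taylor expansions, encoded by iterated difference quotients: f has an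
    expansion of order k when k successive quotients (f z - f 0) / z exist and
    the last one is bounded. This class is stable under products and inverses
    without any manipulation of power series. *)
Fixpoint taylor (k : nat) f : Prop :=
  match k with
  | 0 => exists K : C, \forall z \near (0 : C), `|f z| <= K
  | k'.+1 => exists g, taylor k' g /\ \forall z \near (0 : C), f z = f 0 + z * g z
  end.

Lemma taylor0I (K : C) f : (\forall z \near (0 : C), `|f z| <= K) -> taylor 0 f.
Proof. by move=> h; exists K. Qed.

Lemma taylorSI k f g : taylor k g -> (\forall z \near (0 : C), f z = f 0 + z * g z) ->
  taylor k.+1 f.
Proof. by move=> tg fg; exists g. Qed.

Lemma taylor_ext k f g : (\forall z \near (0 : C), f z = g z) -> taylor k f -> taylor k g.
Proof.
case: k => [|k] fg.
  case=> K hK; apply: (@taylor0I K); near=> z.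
  by rewrite -(near fg z)//; near: z.
case=> h [th fh]; apply: (taylorSI th); near=> z.
by rewrite -(near fg z)// -(nbhs_singleton fg); near: z.
Unshelve. all: by end_near. Qed.

Lemma near0_le1 : \forall z \near (0 : C), `|z| <= 1.
Proof.
apply/nbhs_ballP; exists 1 => //= z.
by rewrite /ball/= sub0r normrN => /ltW.
Qed.

Lemma taylorW k f : taylor k.+1 f -> taylor k f.
Proof.
elim: k f => [|k IH] f [g [tg fg]].
  case: tg => K hK; apply: (@taylor0I (`|f 0| + K)); near=> z.
  rewrite (near fg z)//; apply: (le_trans (ler_normD _ _)); rewrite lerD2l normrM.
  apply: (@le_trans _ _ `|g z|); last by near: z.
  by rewrite ler_piMl//; near: z; exact: near0_le1.
by apply: (taylorSI (IH _ tg)).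
Unshelve. all: by end_near. Qed.

Lemma taylor_cst k (c : C) : taylor k (fun=> c).
Proof.
elim: k c => [|k IH] c; first by apply: (@taylor0I `|c|); apply: near_all => z; exact: lexx.
by apply: (taylorSI (IH 0)); apply: near_all => z; rewrite mulr0 addr0.
Qed.

Lemma taylorD k f g : taylor k f -> taylor k g -> taylor k (fun z => f z + g z).
Proof.
elim: k f g => [|k IH] f g.
  case=> K hK [L hL]; apply: (@taylor0I (K + L)); near=> z.
  by apply: (le_trans (ler_normD _ _)); apply: lerD; near: z.
case=> f' [tf ff] [g' [tg gg]]; apply: (taylorSI (IH _ _ tf tg)).
near=> z; rewrite (near ff z)// (near gg z)//; ring.
Unshelve. all: by end_near. Qed.

(** The difference quotient of f g is f' g + f(0) g'. *)
Lemma taylorM k f g : taylor k f -> taylor k g -> taylor k (fun z => f z * g z).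
Proof.
elim: k f g => [|k IH] f g.
  case=> K hK [L hL]; apply: (@taylor0I (K * L)); near=> z.
  by rewrite normrM; apply: ler_pM => //; near: z.
move=> tf tg; have tf' := taylorW tf; have tg' := taylorW tg.
case: tf => f' [tf ff]; case: tg => g' [tg gg].
apply: (@taylorSI _ _ (fun z => f' z * g z + f 0 * g' z)).
  by apply: taylorD; apply: IH => //; exact: taylor_cst.
near=> z; rewrite mulrDr mulrA.
rewrite (_ : f z = f 0 + z * f' z); last by near: z.
rewrite [in LHS](_ : g z = g 0 + z * g' z); last by near: z.
rewrite [in RHS](_ : g z = g 0 + z * g' z); last by near: z.
ring.
Unshelve. all: by end_near. Qed.

Lemma taylor_cvg k f : taylor k.+1 f -> f @ (0 : C) --> f 0.
Proof.
move=> tf; have {tf} : taylor 1 f by elim: k tf => // k IH /taylorW.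
case=> g [[K hK] fg].
have K0 : 0 <= K by have := nbhs_singleton hK; apply: le_trans.
apply/cvg_atP => e e0.
near=> z; rewrite (near fg z)// opprD addrA subrr sub0r normrN normrM.
apply: (@le_trans _ _ (e / (K + 1) * K)).
  apply: ler_pM => //; last by near: z.
  near: z; apply/nbhs_ballP; exists (e / (K + 1)) => /=.
    by rewrite divr_gt0// ltr_wpDl.
  by move=> z; rewrite /ball/= sub0r normrN => /ltW.
rewrite mulrAC ler_pdivrMr ?ltr_wpDl// ler_pM2l// lerDl ler01.
by [].
Unshelve. all: by end_near. Qed.

(** The difference quotient of 1/f is - f' / (f(0) f). *)
Lemma taylorV f : (forall k, taylor k f) -> f 0 != 0 -> forall k, taylor k (fun z => (f z)^-1).
Proof.
move=> tf f0; have fc := taylor_cvg (tf 1%N).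
have fn0 : \forall z \near (0 : C), f z != 0 by exact: (@cvgr_neq0 C C C (nbhs (0:C)) _ f _ fc f0).
elim=> [|k IH].
  have fVc : (fun z => (f z)^-1) @ (0 : C) --> (f 0)^-1.
    exact: (@cvgV C C (nbhs (0 : C)) _ f _ f0 fc).
  have h : \forall z \near (0 : C), `|(f 0)^-1 - (f z)^-1| <= 1 by exact: (iffLR (cvg_atP _ _ _) fVc _ ltr01).
  apply: (@taylor0I (`|(f 0)^-1| + 1)); near=> z.
  rewrite -[X in `|X|](subKr (f 0)^-1); apply: (le_trans (ler_normB _ _)).
  by rewrite lerD2l; near: z.
case: (tf k.+1) => g [tg fg].
apply: (@taylorSI _ _ (fun z => (- (f 0)^-1) * (g z * (f z)^-1))).
  by apply: taylorM; [exact: taylor_cst|apply: taylorM].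
near=> z.
have fz : f z != 0 by near: z.
have e' : f z = f 0 + z * g z by near: z.
have e : z * g z = f z - f 0 by rewrite [in RHS]e' addrC addKr.
rewrite (_ : z * (- (f 0)^-1 * (g z * (f z)^-1)) = - (f 0)^-1 * (z * g z) * (f z)^-1); last by ring.
by rewrite e; field; rewrite f0 fz.
Unshelve. all: by end_near. Qed.

(** The part of analyticity that is used: Taylor expansions allow one to compare
    leading coefficients at 0, and continuity near 0 turns identities that hold
    off a discrete set into identities that hold everywhere near 0. *)
Definition regular f := (forall k, taylor k f) /\ \forall z \near (0 : C), {for z, continuous f}.

Lemma regular_ext f g : (\forall z \near (0 : C), f z = g z) -> regular f -> regular g.
Proof.
move=> fg [tf cf]; split=> [k|]; first exact: taylor_ext (tf k).
have fg2 := near_join fg.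
apply: near_imply2 cf fg2 => z fz h.
have gz : g @ z --> f z by exact: cvg_at_ext h fz.
by rewrite /prop_for /continuous_at -(nbhs_singleton h).
Qed.

Lemma regular_cst (c : C) : regular (fun=> c).
Proof. by split=> [k|]; [exact: taylor_cst|apply: near_all => z; exact: (@cvg_cst C c C (nbhs z))]. Qed.

Lemma regularD f g : regular f -> regular g -> regular (fun z => f z + g z).
Proof.
move=> [tf cf] [tg cg]; split=> [k|]; first exact: taylorD.
apply: near_imply2 cf cg => z h1 h2.
exact: (@cvgD C C C (nbhs z) _ f g _ _ h1 h2).
Qed.

Lemma regularM f g : regular f -> regular g -> regular (fun z => f z * g z).
Proof.
move=> [tf cf] [tg cg]; split=> [k|]; first exact: taylorM.
apply: near_imply2 cf cg => z h1 h2.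
exact: (@cvgM C C (nbhs z) _ f g _ _ h1 h2).
Qed.

Lemma regular_cvg f : regular f -> f @ (0 : C) --> f 0.
Proof. by move=> [tf _]; exact: taylor_cvg (tf 1%N). Qed.

Lemma regularV f : regular f -> f 0 != 0 -> regular (fun z => (f z)^-1).
Proof.
move=> rf f0; have fn0 : \forall z \near (0 : C), f z != 0.
  exact: (@cvgr_neq0 C C C (nbhs (0:C)) _ f _ (regular_cvg rf) f0).
case: rf => [tf cf]; split=> [|]; first exact: taylorV.
apply: near_imply2 fn0 cf => z fz h1.
exact: (@cvgV C C (nbhs z) _ f _ fz h1).
Qed.

Lemma regular_sum (I : Type) (s : seq I) (P : pred I) (F : I -> C -> C) :
  (forall i, P i -> regular (F i)) -> regular (fun z => \sum_(i <- s | P i) F i z).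
Proof.
move=> rF; elim: s => [|i s IH].
  by apply: regular_ext (regular_cst 0); apply: near_all => z; rewrite big_nil.
case Pi : (P i).
  by apply: regular_ext (regularD (rF _ Pi) IH); apply: near_all => z; rewrite big_cons Pi.
by apply: regular_ext IH; apply: near_all => z; rewrite big_cons Pi.
Qed.

Lemma regular_prod (I : Type) (s : seq I) (P : pred I) (F : I -> C -> C) :
  (forall i, P i -> regular (F i)) -> regular (fun z => \prod_(i <- s | P i) F i z).
Proof.
move=> rF; elim: s => [|i s IH].
  by apply: regular_ext (regular_cst 1); apply: near_all => z; rewrite big_nil.
case Pi : (P i).
  by apply: regular_ext (regularM (rF _ Pi) IH); apply: near_all => z; rewrite big_cons Pi.
by apply: regular_ext IH; apply: near_all => z; rewrite big_cons Pi.
Qed.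

End Taylor.

Section Analytic.
Variable R : realType.
Local Notation C := (Cplx R).
Implicit Types (f g : C -> C) (u : nat -> C).

Definition sums_to u (r : C) f := forall z, `|z| < r -> series (fun n => u n * z ^+ n) @ \oo --> f z.

(** Convergence at r/2 bounds u_n (r/2)^n, hence geometric decay for |z| < r/4. *)
Lemma sums_to_geo u r f : 0 < r -> sums_to u r f ->
  exists rho K, 0 < rho <= r /\
    forall z, `|z| < rho -> forall n, `|u n * z ^+ n| <= K * (1/2) ^+ n.
Proof.
move=> r0 uf.
have r2 : `|r / 2| = r / 2 by rewrite ger0_norm// divr_ge0// ltW.
have r2r : `|r / 2| < r by rewrite r2 gtr_pMr// invf_lt1// ltr1n.
have /cvg_norm_bounded[K K0 hK] : (fun n => u n * (r / 2) ^+ n) @ \oo --> (0 : C).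
  apply: cvg_series_cvg_0; apply/cvg_ex; exists (f (r / 2)); exact: uf.
exists (r / 4), K; split.
  by rewrite divr_gt0//= ler_pdivrMr// ler_peMr ?ler1n// ltW.
move=> z zr n; rewrite normrM normrX.
apply: (@le_trans _ _ (`|u n| * (r / 2 * (1 / 2)) ^+ n)).
  rewrite ler_wpM2l// lerXn2r ?nnegrE ?mulr_ge0 ?divr_ge0 ?(ltW r0)//.
  by apply: (le_trans (ltW zr)); rewrite le_eqVlt; apply/orP; left; apply/eqP; field.
rewrite exprMn mulrA ler_wpM2r ?exprn_ge0 ?divr_ge0//.
by have := hK n; rewrite normrM normrX r2.
Qed.

Lemma series_at0 u : series (fun n => u n * 0 ^+ n) @ \oo --> u 0%N.
Proof.
apply: (iffRL (@cvgrPdist_le C C nat \oo _ _ _)) => e e0.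
exists 1%N => // -[//|n] _.
rewrite /series/= big_nat_recl//= expr0 mulr1 big1 ?addr0 ?subrr ?normr0 ?ltW//.
by move=> i _; rewrite expr0n mulr0.
Qed.

Lemma sums_to_0 u r f : 0 < r -> sums_to u r f -> f 0 = u 0%N.
Proof.
move=> r0 /(_ 0); rewrite normr0 => /(_ r0) h.
by rewrite -(norm_cvg_lim h) (norm_cvg_lim (@series_at0 u)).
Qed.

Lemma near_ball0 (r : C) : 0 < r -> \forall z \near (0 : C), `|z| < r.
Proof.
move=> r0; apply/nbhs_ballP; exists r => //= z.
by rewrite /ball/= sub0r normrN.
Qed.

Let half := half_ratio R.

(** The difference quotient of a power series is the shifted power series. *)
Lemma sums_to_taylor k u r f : 0 < r -> sums_to u r f -> taylor k f.
Proof.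
elim: k u f => [|k IH] u f r0 uf.
  have [rho [K [/andP[rho0 rhor] hK]]] := sums_to_geo r0 uf.
  apply: (@taylor0I _ (K / (1 - 1/2))).
  apply: near_imply (near_ball0 rho0) => z zr.
  have := series_geo_tail 0 half (hK z zr).
  rewrite /series/= big_geq// subr0 expr0 mulr1.
  by rewrite (norm_cvg_lim (uf z (lt_le_trans zr rhor))).
pose g z := if z == 0 then u 1%N else (f z - f 0) / z.
apply: (@taylorSI _ _ _ g); last first.
  apply: near_all => z; rewrite /g; case: eqVneq => [->|z0]; first by rewrite mul0r addr0.
  by rewrite mulrC divfK// addrC subrK.
apply: (IH (fun n => u n.+1) g r0) => z zr; rewrite /g; case: eqVneq => [->|z0].
  exact: series_at0.
have h := uf z zr.
have -> : series (fun n => u n.+1 * z ^+ n) = (fun n => (series (fun n => u n * z ^+ n) n.+1 - f 0) * z^-1).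
  apply/funext => n; rewrite (sums_to_0 r0 uf) /series/= big_nat_recl// expr0 mulr1 addrC addKr.
  by rewrite big_distrl/=; apply: eq_bigr => i _; rewrite exprSr; field.
apply: cvgM; last exact: cvg_cst.
apply: cvgB; last exact: cvg_cst.
by rewrite (cvg_shiftS (series (fun n => u n * z ^+ n))).
Qed.

Lemma exprC_cvg (c : C) n : (fun z : C => z ^+ n) @ c --> c ^+ n.
Proof.
elim: n => [|n IH]; first exact: (@cvg_cst C _ C (nbhs c)).
have -> : (fun z : C => z ^+ n.+1) = (fun z => z * z ^+ n) by apply/funext => z; rewrite exprS.
by rewrite exprS; apply: (@cvgM C C (nbhs c) _ id _ _ _ _ IH); exact: cvg_id.
Qed.

(** A power series is a uniform limit of polynomials near 0. *)
Lemma sums_to_continuous u r f : 0 < r -> sums_to u r f ->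
  \forall z \near (0 : C), {for z, continuous f}.
Proof.
move=> r0 uf.
have [rho [K [/andP[rho0 rhor] hK]]] := sums_to_geo r0 uf.
have tail z N : `|z| < rho -> `|f z - series (fun n => u n * z ^+ n) N| <= K / (1 - 1/2) * (1/2) ^+ N.
  move=> zr; have := series_geo_tail N half (hK z zr).
  by rewrite (norm_cvg_lim (uf z (lt_le_trans zr rhor))).
apply: near_imply (near_join (near_ball0 rho0)) => c hc.
have cr := nbhs_singleton hc.
apply/cvg_atP => e e0.
have e3 : 0 < e / 3 by rewrite divr_gt0.
have [N hN] : exists N, `|(1/2) ^+ N * (K / (1 - 1/2))| <= e / 3.
  by apply: exists_exp_small => //; rewrite ger0_norm; case/andP: half.
pose S z := series (fun n => u n * z ^+ n) N.
have tail' z : `|z| < rho -> `|f z - S z| <= e / 3.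
  move=> zr; apply: le_trans hN; apply: (le_trans (tail z N zr)).
  have h0 := le_trans (normr_ge0 _) (tail z N zr).
  by rewrite -(ger0_norm h0) mulrC.
have Sc : S @ c --> S c.
  rewrite /S /series/=; elim: N {hN S tail'} => [|N IH].
    have -> : (fun z : C => \sum_(0 <= n < 0) u n * z ^+ n) = (fun=> 0) by apply/funext => z; rewrite big_geq.
    have -> : \sum_(0 <= n < 0) u n * c ^+ n = 0 by rewrite big_geq.
    exact: (@cvg_cst C 0 C (nbhs c)).
  have -> : (fun z : C => \sum_(0 <= n < N.+1) u n * z ^+ n) =
      (fun z => \sum_(0 <= n < N) u n * z ^+ n) + (fun z => u N * z ^+ N).
    by apply/funext => z; rewrite big_nat_recr.
  have -> : \sum_(0 <= n < N.+1) u n * c ^+ n =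
      \sum_(0 <= n < N) u n * c ^+ n + u N * c ^+ N by rewrite big_nat_recr.
  apply: (@cvgD C C C (nbhs c) _ _ _ _ _ IH).
  apply: (@cvgM C C (nbhs c)); first exact: (@cvg_cst C _ C (nbhs c)).
  exact: exprC_cvg.
have := iffLR (cvg_atP _ _ _) Sc _ e3.
apply: near_imply2 hc => z zr Sz.
have -> : f c - f z = (f c - S c) + (S c - S z) - (f z - S z) by ring.
apply: (le_trans (ler_normB _ _)); rewrite (_ : e = e / 3 + e / 3 + e / 3); last by field.
apply: lerD; last exact: tail'.
by apply: (le_trans (ler_normD _ _)); apply: lerD => //; exact: tail'.
Qed.

Lemma analytic_regular f : analytic_at f 0 -> regular f.
Proof.
move=> [u [r [r0 uf]]].
have uf' : sums_to u r f.
  by move=> z zr; have := uf z; rewrite !subr0; apply.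
by split=> [k|]; [exact: sums_to_taylor uf'|exact: sums_to_continuous uf'].
Qed.

End Analytic.

(** * Properties that hold off a discrete subset of C^* *)
Lemma int_lt_addSn (m n : int) : m < n -> m + Posz (`|n - m|.-1.+1)%N = n.
Proof. by move=> mn; lia. Qed.

Section AlmostEverywhere.
Variable R : realType.
Local Notation C := (Cplx R).
Implicit Types (f g : C -> C) (c : C) (P Q S : C -> Prop).

Lemma dnbhsP c P : (\forall z \near c^', P z) <-> (\forall z \near c, z != c -> P z).
Proof. by []. Qed.

Lemma near_ae c P : (\forall z \near c, P z) -> \forall z \near c^', P z.
Proof. by move=> h; apply/dnbhsP; apply: near_imply h. Qed.

Lemma dnbhs_imply c P S : (forall z, P z -> S z) ->
  (\forall z \near c^', P z) -> \forall z \near c^', S z.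
Proof. by move=> PS; apply: filterS. Qed.

Lemma dnbhs_imply2 c P Q S : (forall z, P z -> Q z -> S z) ->
  (\forall z \near c^', P z) -> (\forall z \near c^', Q z) -> \forall z \near c^', S z.
Proof. by move=> PQS; apply: filterS2. Qed.

Lemma dnbhs_comp c f P : f @ c --> f c -> (forall z, f z = f c -> z = c) ->
  (\forall z \near (f c)^', P z) -> \forall z \near c^', P (f z).
Proof.
move=> fc fi /dnbhsP h; apply/dnbhsP.
have h2 : \forall z \near c, f z != f c -> P (f z) by exact: fc h.
apply: near_imply h2 => z h2 zc; apply: h2; apply: contra zc => /eqP/fi ->; exact: eqxx.
Qed.

Lemma scale_cvg (a c : C) : (fun z => a * z) @ c --> a * c.
Proof. by apply: (@cvgM C C (nbhs c)); [exact: (@cvg_cst C _ C (nbhs c))|exact: cvg_id]. Qed.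

Lemma eq_of_dnbhs f g c : f @ c --> f c -> g @ c --> g c ->
  (\forall z \near c^', f z = g z) -> f c = g c.
Proof.
move=> fc gc fg; apply/eqP; rewrite -subr_eq0 -normr_le0; apply: ler_addeps => // e e0.
have e2 : 0 < e / 2 by rewrite divr_gt0.
have h1 := near_ae (iffLR (cvg_atP f c _) fc _ e2).
have h2 := near_ae (iffLR (cvg_atP g c _) gc _ e2).
have : \forall z \near c^', `|f c - g c| <= 0 + e.
  apply: dnbhs_imply2 (dnbhs_imply2 (fun z a b => conj a b) h1 h2) fg => z [hf hg] e12.
  have -> : f c - g c = (f c - f z) - (g c - g z) by rewrite e12; ring.
  rewrite add0r [leRHS](splitr e); apply: (le_trans (ler_normB _ _)); exact: lerD.
by move/filter_ex => -[].
Qed.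

Lemma ae_and P Q : ae_Cstar P -> ae_Cstar Q -> ae_Cstar (fun z => P z /\ Q z).
Proof. by move=> hP hQ c c0; apply: dnbhs_imply2 (hP c c0) (hQ c c0). Qed.

Lemma ae_imply P S : (forall z, P z -> S z) -> ae_Cstar P -> ae_Cstar S.
Proof. by move=> PS hP c c0; apply: dnbhs_imply (hP c c0). Qed.

Lemma ae_imply2 P Q S : (forall z, P z -> Q z -> S z) -> ae_Cstar P -> ae_Cstar Q -> ae_Cstar S.
Proof. by move=> PS hP hQ c c0; apply: dnbhs_imply2 (hP c c0) (hQ c c0). Qed.

Lemma ae_scale (a : C) P : a != 0 -> ae_Cstar P -> ae_Cstar (fun z => P (a * z)).
Proof.
move=> a0 hP c c0; apply: (@dnbhs_comp c (fun z => a * z)); first exact: scale_cvg.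
  by move=> z; exact: mulfI.
by apply: hP; rewrite mulf_neq0.
Qed.

Lemma ae_inv P : ae_Cstar P -> ae_Cstar (fun z => P z^-1).
Proof.
move=> hP c c0; apply: (@dnbhs_comp c (fun z => z^-1)).
- by apply: (@cvgV C C (nbhs c) _ id c c0); exact: cvg_id.
- by move=> z; exact: invr_inj.
- by apply: hP; rewrite invr_eq0.
Qed.

Lemma ae_neq (a : C) : ae_Cstar (fun z => z != a).
Proof.
move=> c c0; have [->|ca] := eqVneq c a; first by apply/dnbhsP; apply: near_all.
have h : (fun z => z - a) @ c --> c - a.
  by apply: (@cvgB C C C (nbhs c)); [exact: cvg_id|exact: (@cvg_cst C _ C (nbhs c))].
have ca0 : c - a != 0 by rewrite subr_eq0.
apply: near_ae; apply: near_imply (@cvgr_neq0 C C C (nbhs c) _ _ _ h ca0) => z.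
by rewrite subr_eq0.
Qed.

Lemma near_dist_lt (c r : C) : 0 < r -> \forall z \near c, `|c - z| < r.
Proof. by move=> r0; apply/nbhs_ballP; exists r. Qed.

(** The spiral a p^Z is discrete in C^*: two of its points differ by a factor of
    modulus at most |p|, so they cannot both lie in a small disk around c. *)
Lemma ae_neq_spiral (p a : C) : p != 0 -> `|p| < 1 -> a != 0 ->
  ae_Cstar (fun z => forall n : int, z <> a * p ^ n).
Proof.
move=> p0 p1 a0 c c0.
(* This relative radius gives (1 - s) / (1 + s) = |p|. *)
pose s := (1 - `|p|) / (1 + `|p|).
have pp : 0 < 1 + `|p| by rewrite ltr_wpDr.
have s0 : 0 < s by rewrite divr_gt0 ?subr_gt0.
have sc0 : 0 < s * `|c| by rewrite mulr_gt0 ?normr_gt0.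
have es : 1 - s = `|p| * (1 + s) by rewrite /s; field; rewrite gt_eqF.
have lower z : `|c - z| < s * `|c| -> (1 - s) * `|c| < `|z|.
  move=> h; rewrite mulrBl mul1r ltrBlDr; apply: le_lt_trans (_ : `|z| + `|c - z| < _); last by rewrite ltrD2l.
  by rewrite -{1}(subrKC z c); exact: ler_normD.
have upper z : `|c - z| < s * `|c| -> `|z| < (1 + s) * `|c|.
  move=> h; rewrite mulrDl mul1r; apply: le_lt_trans (_ : `|c| + `|c - z| < _); last by rewrite ltrD2l.
  by rewrite -{1}(subKr c z); exact: ler_normB.
have uniq (n : int) (k : nat) : `|c - a * p ^ n| < s * `|c| ->
    `|c - a * p ^ (n + Posz k.+1)| < s * `|c| -> False.
  move=> h1 h2; have := lower _ h2.
  suff h3 : `|a * p ^ (n + Posz k.+1)| <= (1 - s) * `|c| by move/lt_le_trans/(_ h3); rewrite ltxx.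
  rewrite expfzDr// mulrA normrM es -mulrA mulrC; apply: ler_pM => //; last exact: ltW (upper _ h1).
  by rewrite -exprnP normrX exprS ler_piMr//; apply: exprn_ile1 => //; exact: ltW.
have [[z0 [zb [n0 zn]]]|no] := pselect (exists z0, `|c - z0| < s * `|c| /\ exists n : int, z0 = a * p ^ n).
  apply: dnbhs_imply2 (ae_neq z0 c0) (near_ae (near_dist_lt c sc0)) => z zz0 zc n zE.
  have nn : n != n0 by apply/eqP => e; case/eqP: zz0; rewrite zE zn e.
  rewrite {}zE in zc zz0; rewrite {}zn in zb zz0.
  case: (ltgtP n n0) => [lt|lt|e]; last by rewrite e eqxx in nn.
    apply: (uniq n `|n0 - n|.-1%N) => //.
    by rewrite int_lt_addSn.
  apply: (uniq n0 `|n - n0|.-1%N) => //.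
  by rewrite int_lt_addSn.
apply: near_ae; apply: near_imply (near_dist_lt c sc0) => z zc n zE.
by apply: no; exists z; split=> //; exists n.
Qed.

(** Analytic continuation along the dynamics z |-> p z: every orbit enters the
    disk of radius r, and each step back preserves the property. *)
Lemma ae_spread (p : C) P : p != 0 -> `|p| < 1 ->
  (exists2 r : C, 0 < r & forall z, z != 0 -> `|z| < r -> P z) ->
  ae_Cstar (fun z => P (p * z) -> P z) -> ae_Cstar P.
Proof.
move=> p0 p1 [r r0 hr] hP.
suff h n c : c != 0 -> `|p ^+ n * c| < r -> \forall z \near c^', P z.
  move=> c c0; have r2 : 0 < r / 2 by rewrite divr_gt0.
  have [n hn] := exists_exp_small p1 c r2.
  apply: (h n c c0); apply: (le_lt_trans hn).
  by rewrite gtr_pMr// invf_lt1// ltr1n.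
elim: n c => [|n IH] c c0 hc.
  rewrite mul1r in hc.
  have rc : 0 < r - `|c| by rewrite subr_gt0.
  apply: dnbhs_imply2 (ae_neq 0 c0) (near_ae (near_dist_lt c rc)) => z z0 zc; apply: hr => //.
  rewrite -(subKr c z); apply: (le_lt_trans (ler_normB _ _)).
  by rewrite -ltrBrDl.
have hpc : \forall z \near (p * c)^', P z.
  by apply: IH; [rewrite mulf_neq0|rewrite mulrA -exprSr].
apply: dnbhs_imply2 (hP c c0) (dnbhs_comp (@scale_cvg p c) _ hpc) => z.
  by move=> h1 h2; exact: h1.
by exact: mulfI.
Qed.

End AlmostEverywhere.

(** * First-order scalar q-difference equations *)
Section ScalarEquation.
Variable R : realType.
Local Notation C := (Cplx R).
Implicit Types (x y : C -> C) (d : C).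
Variables (p al be : C).
Hypotheses (p0 : p != 0) (p1 : `|p| < 1).

Let E z := qpoch p (al * z) * qpoch p (be * z).
Let g z := (1 - al * z) * (1 - be * z).
Let part z N := qpoch_part p (al * z) N * qpoch_part p (be * z) N.

Lemma qpoch2_neq0 : exists2 r : C, 0 < r & forall z, `|z| < r -> E z != 0.
Proof.
have small (a : C) : forall z, `|z| < (1 + `|a|)^-1 -> qpoch p (a * z) != 0.
  move=> z zr; apply/eqP => /(qpoch_eq0 p1)[n /(congr1 Num.norm)].
  apply/eqP; rewrite normr1 lt_eqF// !normrM normrX.
  apply: (@le_lt_trans _ _ (`|a| * `|z|)).
    by apply: ler_piMl; rewrite ?mulr_ge0//; apply: exprn_ile1 => //; exact: ltW.
  apply: (@le_lt_trans _ _ ((1 + `|a|) * `|z|)); first by rewrite ler_wpM2r// lerDr.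
  by rewrite -ltr_pdivlMl ?mulr1// ltr_wpDr.
exists ((1 + `|al|)^-1 * (1 + `|be|)^-1).
  by rewrite mulr_gt0// invr_gt0 ltr_wpDr.
move=> z zr; rewrite mulf_neq0//; apply: small; apply: (lt_le_trans zr).
  by rewrite ler_piMr ?invr_ge0 ?addr_ge0// invf_le1 ?lerDl// ltr_wpDr.
by rewrite ler_piMl ?invr_ge0 ?addr_ge0// invf_le1 ?lerDl// ltr_wpDr.
Qed.

Lemma part_cvg z : part z @ \oo --> E z.
Proof. by apply: cvgM; exact: qpoch_cvg. Qed.

(** The scalar q-difference equation (1 - al z) (1 - be z) x(z) = d x(p z); for
    d = 1 it is solved by 1 / [E]. *)
Definition solves d x (r : C) := forall z, z != 0 -> `|z| < r -> x z * g z = d * x (p * z).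

Let ball_p z (r : C) : `|z| < r -> `|p * z| < r.
Proof. by apply: le_lt_trans; rewrite normrM ler_piMl// ltW. Qed.

Lemma solves_iter d x r N z : solves d x r -> z != 0 -> `|z| < r ->
  x z * part z N = d ^+ N * x (p ^+ N * z).
Proof.
move=> sx; elim: N z => [|N IH] z z0 zr.
  by rewrite /part /qpoch_part !big_geq// !mulr1 expr0 !mul1r.
rewrite /part !qpoch_partS !(mulrCA p).
transitivity ((x z * g z) * part (p * z) N); first by rewrite /part /g; ring.
rewrite sx// -mulrA IH ?mulf_neq0//; last exact: ball_p.
by rewrite (exprS d) (exprSr p) !mulrA.
Qed.

Lemma cvg0_geo (u : nat -> C) (K r : C) : 0 <= r < 1 ->
  (forall n, `|u n| <= K * r ^+ n) -> u @ \oo --> (0 : C).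
Proof. by move=> rr uK; apply: cvg_series_cvg_0; exact: series_geoC_cvg uK. Qed.

Lemma near0P (P : C -> Prop) : (\forall z \near (0 : C), P z) <->
  exists2 r : C, 0 < r & forall z, `|z| < r -> P z.
Proof.
split=> [/nbhs_ballP[r r0 h]|[r r0 h]].
  by exists r => // z zr; apply: h; rewrite /ball/= sub0r normrN.
by apply: near_imply (near_ball0 r0) => z; exact: h.
Qed.

Lemma exists_pos_le2 (r s : C) : 0 < r -> 0 < s -> exists t : C, [/\ 0 < t, t <= r & t <= s].
Proof.
move=> r0 s0; have [rs|sr] := real_leP (gtr0_real r0) (gtr0_real s0).
  by exists r.
by exists s; split=> //; exact: ltW.
Qed.

Lemma g_cvg0 : g @ (0 : C) --> (1 : C).
Proof.
have h (a : C) : (fun z => 1 - a * z) @ (0 : C) --> (1 : C).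
  have e : 1 - a * 0 = 1 :> C by rewrite mulr0 subr0.
  rewrite -[X in _ --> X]e.
  by apply: (@cvgB C C C (nbhs (0 : C))); [exact: (@cvg_cst C _ C (nbhs (0:C)))|exact: scale_cvg].
by rewrite -[X in _ --> X]mulr1; exact: (@cvgM C C (nbhs (0 : C)) _ _ _ _ _ (h al) (h be)).
Qed.

(** The equation at z = 0, by continuity. *)
Lemma solves_at0 d x r : 0 < r -> x @ (0 : C) --> x 0 -> solves d x r -> x 0 = d * x 0.
Proof.
move=> r0 x0 sx.
have := @eq_of_dnbhs R (fun z => x z * g z) (fun z => d * x (p * z)) 0.
have -> : x 0 * g 0 = x 0 by rewrite /g !mulr0 subr0 !mulr1.
rewrite mulr0; apply.
- rewrite -[X in _ --> X]mulr1; exact: (@cvgM C C (nbhs (0 : C)) _ x g _ _ x0 g_cvg0).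
- apply: (@cvgM C C (nbhs (0 : C))); first exact: (@cvg_cst C _ C (nbhs (0:C))).
  have h : (fun z => p * z) @ (0 : C) --> (0 : C) by rewrite -[X in _ --> X](mulr0 p); exact: scale_cvg.
  exact: (cvg_comp _ _ h x0).
- by apply/dnbhsP; apply: near_imply (near_ball0 r0) => z zr z0; exact: sx.
Qed.

(** Dividing a solution by z multiplies d by p. *)
Lemma solves_quotient d x y r : 0 < r -> solves d x r -> x 0 = 0 ->
  (\forall z \near (0 : C), x z = x 0 + z * y z) ->
  exists t : C, [/\ 0 < t, forall z, `|z| < t -> x z = z * y z & solves (d * p) y t].
Proof.
move=> r0 sx x0 /near0P[s s0 hs].
have [t [t0 tr ts]] := exists_pos_le2 r0 s0.
have xy z : `|z| < t -> x z = z * y z.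
  by move=> zt; rewrite hs ?x0 ?add0r//; exact: lt_le_trans ts.
exists t; split=> // z z0 zt; apply: (mulfI z0).
rewrite mulrA -xy// sx//; last exact: lt_le_trans tr.
by rewrite xy ?ball_p//; ring.
Qed.

(** If d is not in p^(-N), then d <> 1 forces x(0) = 0, and dividing by z makes d
    smaller; once |d| < 1 the iterated equation x(z) part_N(z) = d^N x(p^N z)
    tends to x(z) E(z) = 0. *)
Lemma solves_zero k d x r : 0 < r -> taylor k x -> solves d x r ->
  `|d| * `|p| ^+ k < 1 -> (forall j, d * p ^+ j != 1) ->
  exists2 s : C, 0 < s & forall z, z != 0 -> `|z| < s -> x z = 0.
Proof.
have [e e0 he] := qpoch2_neq0.
elim: k d x r => [|k IH] d x r r0.
  move=> [K /near0P[s s0 hs]] sx; rewrite mulr1 => d1 _.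
  have [t1 [t10 t1r t1s]] := exists_pos_le2 r0 s0; have [t [t0 tt1 te]] := exists_pos_le2 t10 e0.
  exists t => // z z0 zt; have zt1 := lt_le_trans zt tt1.
  have h : (fun N => x z * part z N) @ \oo --> (0 : C).
    apply: (@cvg0_geo _ K `|d|) => [|N]; first by rewrite normr_ge0.
    rewrite (solves_iter N sx z0 (lt_le_trans zt1 t1r)) normrM normrX mulrC ler_wpM2r ?exprn_ge0//.
    apply: hs; apply: lt_le_trans t1s; apply: le_lt_trans zt1.
    by rewrite normrM normrX ler_piMl//; apply: exprn_ile1 => //; exact: ltW.
  have h2 : (fun N => x z * part z N) @ \oo --> x z * E z.
    by apply: cvgM; [exact: cvg_cst|exact: part_cvg].
  have : x z * E z = 0 by rewrite -(norm_cvg_lim h2); exact: norm_cvg_lim h.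
  by move/eqP; rewrite mulf_eq0 (negPf (he _ (lt_le_trans zt te))) orbF => /eqP.
move=> tx sx dk dj; have x0 := solves_at0 r0 (taylor_cvg tx) sx.
have {}x0 : x 0 = 0.
  have /eqP : (1 - d) * x 0 = 0 by rewrite mulrBl mul1r -x0 subrr.
  by rewrite mulf_eq0 subr_eq0 eq_sym -[d]mulr1 (negPf (dj 0%N)) => /eqP.
case: tx => y [ty xy0].
have [t [t0 xy sy]] := solves_quotient r0 sx x0 xy0.
have [||t2 t20 h] := IH _ _ _ t0 ty sy.
- by rewrite normrM -mulrA -exprS.
- by move=> j; rewrite -mulrA -exprS.
have [u [u0 ut ut2]] := exists_pos_le2 t0 t20.
exists u => // z z0 zu; rewrite xy ?h ?mulr0//; exact: lt_le_trans zu _.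
Qed.

(** If d = 1, the iterated equation x(z) part_N(z) = x(p^N z) tends to
    x(z) E(z) = x(0). If x(0) = 0, one division by z leads to [solves_zero]. *)
Lemma solves_qpoch d x r : 0 < r -> (forall k, taylor k x) -> solves d x r ->
  (forall j, d * p ^+ j.+1 != 1) -> x 0 = 0 \/ d = 1 ->
  exists2 s : C, 0 < s & forall z, z != 0 -> `|z| < s -> x z * E z = x 0.
Proof.
move=> r0 tx sx dj [x0|d1].
  have h2 : 0 < 1 / 2 :> C by rewrite divr_gt0.
  have [k hk] := exists_exp_small p1 (d * p) h2.
  case: (tx k.+1) => y [ty xy0].
  have [t [t0 xy sy]] := solves_quotient r0 sx x0 xy0.
  have [||t2 t20 h] := solves_zero t0 ty sy.
  - rewrite mulrC -normrX -normrM; apply: (le_lt_trans hk).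
    by rewrite ltr_pdivrMr// mul1r ltr1n.
  - by move=> j; rewrite -mulrA -exprS.
  have [u [u0 ut ut2]] := exists_pos_le2 t0 t20.
  by exists u => // z z0 zu; rewrite x0 xy ?h ?mulr0 ?mul0r//; exact: lt_le_trans zu _.
exists r => // z z0 zr.
have h2 : (fun N => x z * part z N) @ \oo --> x z * E z.
  by apply: cvgM; [exact: cvg_cst|exact: part_cvg].
rewrite -(norm_cvg_lim h2); apply: norm_cvg_lim.
have pz : (fun N => p ^+ N * z) @ \oo --> (0 : C).
  rewrite -[X in _ --> X](mul0r z); apply: cvgM; [exact: cvg_expC|exact: cvg_cst].
have := cvg_comp _ _ pz (taylor_cvg (tx 1%N)).
have -> : (fun N => x z * part z N) = x \o (fun N => p ^+ N * z); last by apply.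
by apply/funext => N; rewrite (solves_iter N sx z0 zr) d1 expr1n mul1r.
Qed.

End ScalarEquation.

(** * Diagonal matrices in a given basis *)

Section DiagIn.
Variables (F : numClosedFieldType) (n : nat).
Implicit Types (V W B : 'M[F]_n) (d e f g : 'I_n -> F).

(** The matrix with eigenbasis V and eigenvalues d: B and all the Lambda matrices
    built on it are of this form for one V, so that computing with them reduces
    to computing with eigenvalues. *)
Definition diag_in V d : 'M[F]_n := V *m diag_mx (\row_i d i) *m invmx V.

Lemma eq_diag_in V d e : d =1 e -> diag_in V d = diag_in V e.
Proof. by move=> de; congr (_ *m diag_mx _ *m _); apply/rowP => i; rewrite !mxE. Qed.

Lemma diag_inM V d e : V \in unitmx ->
  diag_in V d *m diag_in V e = diag_in V (fun i => d i * e i).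
Proof.
move=> Vu; rewrite /diag_in !mulmxA (mulmxKV Vu) -(mulmxA V).
congr (_ *m _ *m _); apply/matrixP => i j; rewrite mul_diag_mx !mxE.
by case: eqVneq => [->|_]; rewrite ?mulr1n// !mulr0n mulr0.
Qed.

Lemma diag_in_cst V (a : F) : V \in unitmx -> diag_in V (fun=> a) = a%:M.
Proof.
move=> Vu; rewrite /diag_in (_ : \row_i a = const_mx a); last by apply/rowP => i; rewrite !mxE.
by rewrite diag_const_mx mul_mx_scalar -scalemxAl mulmxV// scalemx1.
Qed.

Lemma diag_inZ V (a : F) d : a *: diag_in V d = diag_in V (fun i => a * d i).
Proof.
rewrite /diag_in scalemxAl scalemxAr; congr (_ *m _ *m _).
by apply/matrixP => i j; rewrite !mxE mulrnAr.
Qed.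

Lemma diag_in_unit V d : V \in unitmx -> (diag_in V d \in unitmx) = [forall i, d i != 0].
Proof.
move=> Vu; rewrite !unitmx_mul unitmx_inv Vu/= andbT unitmxE det_diag unitfE.
apply/prodf_neq0/forallP => [h i|h i _]; last by rewrite mxE; exact: h.
by have := h i isT; rewrite mxE.
Qed.

Lemma diag_inV V d : V \in unitmx -> (forall i, d i != 0) ->
  invmx (diag_in V d) = diag_in V (fun i => (d i)^-1).
Proof.
move=> Vu d0; have u : diag_in V d \in unitmx by rewrite diag_in_unit//; apply/forallP.
apply: (can_inj (mulKmx u)); rewrite mulmxV// diag_inM// -(diag_in_cst 1 Vu).
by apply: eq_diag_in => i; rewrite divff.
Qed.

(** Functional calculus does not depend on the diagonalization: the change of
    basis T satisfies T_ij d_j = e_i T_ij, hence also T_ij f(d_j) = f(e_i) T_ij. *)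
Lemma diag_in_fun (f : F -> F) V W d e : V \in unitmx -> W \in unitmx ->
  diag_in V d = diag_in W e ->
  diag_in V (fun i => f (d i)) = diag_in W (fun i => f (e i)).
Proof.
move=> Vu Wu VW; have [T TE] : exists T, T = invmx W *m V by eexists.
have Te : T *m diag_mx (\row_i d i) = diag_mx (\row_i e i) *m T.
  have := congr1 (mulmx^~ V) (congr1 (mulmx (invmx W)) VW).
  by rewrite /diag_in TE /= !mulmxA (mulmxKV Vu) (mulVmx Wu) mul1mx.
have Tf : T *m diag_mx (\row_i f (d i)) = diag_mx (\row_i f (e i)) *m T.
  apply/matrixP => i j; rewrite mul_mx_diag mul_diag_mx !mxE.
  have /matrixP/(_ i j) := Te; rewrite mul_mx_diag mul_diag_mx !mxE => eij.
  have [->|T0] := eqVneq (T i j) 0; first by rewrite mul0r mulr0.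
  by rewrite (_ : d j = e i) 1?mulrC//; apply: (mulfI T0); rewrite eij mulrC.
rewrite /diag_in; apply: (can_inj (mulKmx (_ : invmx W \in unitmx))); first by rewrite unitmx_inv.
apply: (can_inj (mulmxK Vu)).
by rewrite !mulmxA (mulmxKV Vu) -TE Tf TE mulVmx// mul1mx !mulmxA.
Qed.

Lemma diag_in_eigenvalue V d i : V \in unitmx -> eigenvalue (diag_in V d) (d i).
Proof.
move=> Vu; apply/eigenvalueP; exists (row i (invmx V)).
  rewrite /diag_in !mulmxA -row_mul mulVmx// -row_mul mul1mx -row_mul.
  apply/rowP => j; rewrite !mxE; under eq_bigr do rewrite !mxE.
  rewrite (bigD1 i)//= eqxx mulr1n big1 ?addr0// => k /negPf.
  by rewrite eq_sym => ->; rewrite mul0r.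
apply/eqP => r0; have : row i (invmx V) *m V = 0 by rewrite r0 mul0mx.
rewrite -row_mul mulVmx// => /rowP/(_ i); rewrite !mxE eqxx => /eqP.
by rewrite oner_eq0.
Qed.

Lemma diagonalizable_diag_in B : diagonalizable B ->
  exists V d, V \in unitmx /\ B = diag_in V d.
Proof.
case=> P Pu; rewrite /similar_to/= conjumx// => /diag_mxP[d e].
exists (invmx P), (fun i => d 0 i); split; first by rewrite unitmx_inv.
rewrite /diag_in (_ : \row_i d 0 i = d); last by apply/rowP => i; rewrite mxE.
by rewrite -e invmxK !mulmxA (mulVmx Pu) mul1mx (mulmxKV Pu).
Qed.

End DiagIn.

(** * Comparison of two normalized solutions *)
Section Gauge.
Variable R : realType.
Local Notation C := (Cplx R).

Lemma near0_forall (I : finType) (P : I -> C -> Prop) :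
  (forall i, \forall z \near (0 : C), P i z) -> \forall z \near (0 : C), forall i, P i z.
Proof. by move=> h; exact: (@filter_forall C I P (nbhs (0 : C)) _ h). Qed.

Definition mx_regular m n (H : C -> 'M[C]_(m, n)) := forall i j, regular (fun z => H z i j).

Lemma mx_regularM m n k (H : C -> 'M[C]_(m, n)) (F : C -> 'M[C]_(n, k)) :
  mx_regular H -> mx_regular F -> mx_regular (fun z => H z *m F z).
Proof.
move=> rH rF i j.
have h : regular (fun z => \sum_l H z i l * F z l j).
  by apply: regular_sum => l _; exact: (regularM (rH i l) (rF l j)).
apply: regular_ext h.
by apply: near_all => z; rewrite mxE.
Qed.

Lemma mx_regular_cst m n (A : 'M[C]_(m, n)) : mx_regular (fun=> A).
Proof. by move=> i j; exact: regular_cst. Qed.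

(** The determinant is a polynomial in the entries; the entries of the inverse are
    cofactors divided by the determinant. *)
Lemma regular_det n (H : C -> 'M[C]_n) : mx_regular H -> regular (fun z => \det (H z)).
Proof.
move=> rH; apply: regular_sum => s _; apply: regularM; first exact: regular_cst.
by apply: regular_prod => i _; exact: rH.
Qed.

Lemma near_unitmx n (H : C -> 'M[C]_n) : mx_regular H -> H 0 \in unitmx ->
  \forall z \near (0 : C), H z \in unitmx.
Proof.
move=> rH; rewrite unitmxE unitfE => d0.
have h : \forall z \near (0 : C), \det (H z) != 0.
  exact: (@cvgr_neq0 C C C (nbhs (0 : C)) _ _ _ (regular_cvg (regular_det rH)) d0).
by apply: near_imply h => z; rewrite unitmxE unitfE.
Qed.

Lemma mx_regularV n (H : C -> 'M[C]_n) : mx_regular H -> H 0 \in unitmx ->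
  mx_regular (fun z => invmx (H z)).
Proof.
move=> rH u0 i j; have d0 : \det (H 0) != 0 by rewrite -unitfE -unitmxE.
have rd := regularV (regular_det rH) d0.
have rc : regular (fun z => cofactor (H z) j i).
  apply: regularM; first exact: regular_cst.
  apply: regular_det => k l.
  by apply: regular_ext (rH (lift j k) (lift i l)); apply: near_all => z; rewrite !mxE.
apply: regular_ext (regularM rd rc).
by apply: near_imply (near_unitmx rH u0) => z uz; rewrite /invmx uz !mxE.
Qed.

Variables (p al be : C).
Hypotheses (p0 : p != 0) (p1 : `|p| < 1).
Let E z := qpoch p (al * z) * qpoch p (be * z).
Let g z := (1 - al * z) * (1 - be * z).

Lemma qpoch2_rec z : E z = g z * E (p * z).
Proof. by rewrite /E (qpoch_rec p1 (al * z)) (qpoch_rec p1 (be * z)) !(mulrCA p) /g; ring. Qed.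

(** Both sides of the equation are continuous near 0, so the exceptional set,
    which may accumulate at 0, disappears. *)
Lemma solves_of_ae (x : C -> C) (d r : C) : 0 < r -> regular x ->
  (forall c, c != 0 -> `|c| < r -> \forall z \near c^', x z * g z = d * x (p * z)) ->
  exists2 s : C, 0 < s & solves p al be d x s.
Proof.
move=> r0 [_ /near0P[s s0 cx]] hx.
have [t [t0 tr ts]] := exists_pos_le2 r0 s0.
exists t => // c c0 ct.
have cpt : `|p * c| < t by apply: le_lt_trans ct; rewrite normrM ler_piMl// ltW.
have xc : x @ c --> x c := cx _ (lt_le_trans ct ts).
have xpc : x @ (p * c) --> x (p * c) := cx _ (lt_le_trans cpt ts).
have lin (a : C) : (fun z => 1 - a * z) @ c --> 1 - a * c.
  apply: (@cvgB C C C (nbhs c)); [exact: (@cvg_cst C _ C (nbhs c))|exact: scale_cvg].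
apply: (@eq_of_dnbhs R (fun z => x z * g z) (fun z => d * x (p * z)) c).
- apply: (@cvgM C C (nbhs c) _ x g _ _ xc); exact: (@cvgM C C (nbhs c) _ _ _ _ _ (lin al) (lin be)).
- apply: (@cvgM C C (nbhs c)); first exact: (@cvg_cst C _ C (nbhs c)).
  exact: (cvg_comp _ _ (@scale_cvg R p c) xpc).
- by apply: hx => //; exact: lt_le_trans tr.
Qed.

(** If H solves H(p z) = M H A and F solves the same system twisted by the scalar
    (1 - al z) (1 - be z), then X = H^-1 F satisfies A X(p z) = g(z) X(z) A.
    In an eigenbasis of A this is a scalar equation for each entry, with
    d = c_i / c_j; nonresonance and X(0) = I leave only X = I / [E] near 0, and
    [ae_spread] carries F E = H from there to C^*. *)
Lemma gauge_qpoch n (H F M : C -> 'M[C]_n) (V : 'M[C]_n) (c : 'I_n -> C) :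
  let A := diag_in V c in
  mx_regular H -> mx_regular F -> H 0 = 1%:M -> F 0 = 1%:M ->
  V \in unitmx -> (forall i, c i != 0) ->
  (forall i j k, c i / c j * p ^+ k.+1 != 1) ->
  ae_Cstar (fun z => M z \in unitmx) ->
  ae_Cstar (fun z => H (p * z) = M z *m H z *m A) ->
  ae_Cstar (fun z => F (p * z) = g z *: (M z *m F z *m A)) ->
  ae_Cstar (fun z => E z *: F z = H z).
Proof.
move=> A rH rF H0 F0 Vu c0 cp hM hH hF.
have uA : A \in unitmx by rewrite diag_in_unit//; apply/forallP.
have AE : A = V *m diag_mx (\row_i c i) *m invmx V by [].
clearbody A.
have uH0 : H 0 \in unitmx by rewrite H0 unitmx1.
pose X z := invmx V *m (invmx (H z) *m F z) *m V.
have rX : mx_regular X.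
  apply: mx_regularM; last exact: mx_regular_cst.
  apply: mx_regularM; first exact: mx_regular_cst.
  exact: (mx_regularM (mx_regularV rH uH0) rF).
have X0 : X 0 = 1%:M by rewrite /X H0 F0 invmx1 !mulmx1 mulVmx.
have /near0P[r r0 uH] := near_unitmx rH uH0.
have eqX z : `|z| < r -> M z \in unitmx -> H (p * z) = M z *m H z *m A ->
    F (p * z) = g z *: (M z *m F z *m A) ->
    diag_mx (\row_i c i) *m X (p * z) = g z *: (X z *m diag_mx (\row_i c i)).
  move=> zr uM eH eF.
  have zpr : `|p * z| < r by apply: le_lt_trans zr; rewrite normrM ler_piMl// ltW.
  have e : A *m (invmx (H (p * z)) *m F (p * z)) = g z *: (invmx (H z) *m F z *m A).
    set W := invmx (H (p * z)) *m F (p * z).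
    have eW : H (p * z) *m W = F (p * z) by rewrite mulKVmx ?uH.
    clearbody W.
    have e0 : M z *m (H z *m (A *m W)) = M z *m (g z *: (F z *m A)).
      by rewrite -scalemxAr !mulmxA -eH eW eF.
    have e1 : H z *m (A *m W) = g z *: (F z *m A) by apply: (can_inj (mulKmx uM)).
    by rewrite -mulmxA scalemxAr -e1 mulKmx ?uH.
  have DV : diag_mx (\row_i c i) *m invmx V = invmx V *m A by rewrite AE !mulmxA mulVmx// mul1mx.
  have VD : V *m diag_mx (\row_i c i) = A *m V by rewrite AE mulmxKV.
  have -> : diag_mx (\row_i c i) *m X (p * z) = invmx V *m (A *m (invmx (H (p * z)) *m F (p * z))) *m V.
    by rewrite /X !mulmxA DV.
  have -> : X z *m diag_mx (\row_i c i) = invmx V *m (invmx (H z) *m F z *m A) *m V.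
    by rewrite /X -!mulmxA VD.
  by rewrite e -scalemxAr -scalemxAl.
have XE z : X z = invmx V *m (invmx (H z) *m F z) *m V by [].
clearbody X.
have hX i j : exists2 s : C, 0 < s & forall z, z != 0 -> `|z| < s -> X z i j * E z = X 0 i j.
  pose d := c i / c j.
  have ae_x : forall e, e != 0 -> `|e| < r -> \forall z \near e^', X z i j * g z = d * X (p * z) i j.
    move=> e e0 er; have re : 0 < r - `|e| by rewrite subr_gt0.
    have h1 : \forall z \near e^', `|e - z| < r - `|e| by exact: near_ae (near_dist_lt e re).
    have h2 := ae_and hM (ae_and hH hF) e0.
    apply: dnbhs_imply2 h1 h2 => z ze [uM [eH eF]].
    have zr : `|z| < r.
      rewrite -(subKr e z); apply: (le_lt_trans (ler_normB _ _)).
      by rewrite -ltrBrDl.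
    have := eqX z zr uM eH eF => /matrixP/(_ i j).
    rewrite mul_diag_mx mul_mx_diag !mxE => e1.
    by rewrite /d mulrAC e1; field; exact: c0.
  have [s s0 sx] := solves_of_ae r0 (rX i j) ae_x.
  apply: (solves_qpoch p0 p1 s0 (proj1 (rX i j)) sx (cp i j)).
  rewrite X0 mxE /d; case: eqVneq => [->|_]; [right|by left].
  by rewrite divff.
have hE : \forall z \near (0 : C), z != 0 -> E z *: F z = H z.
  have h : \forall z \near (0 : C), forall ij : 'I_n * 'I_n, z != 0 -> X z ij.1 ij.2 * E z = X 0 ij.1 ij.2.
    apply: near0_forall => -[i j]; have [s s0 sx] := hX i j.
    by apply: near_imply (near_ball0 s0) => z zs z0; exact: sx.
  apply: near_imply2 h (near_ball0 r0) => z hz zr z0.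
  have e1 : E z *: X z = 1%:M.
    by apply/matrixP => i j; rewrite -X0 -(hz (i, j) z0) mxE mulrC.
  have e2 : E z *: (invmx (H z) *m F z) = 1%:M.
    have := congr1 (fun Y => V *m Y *m invmx V) e1; rewrite /= XE mulmx1 (mulmxV Vu) => <-.
    rewrite -scalemxAr -scalemxAl; congr (_ *: _).
    by rewrite !mulmxA (mulmxV Vu) mul1mx (mulmxK Vu).
  by rewrite -[RHS]mulmx1 -e2 -scalemxAr mulKVmx ?uH.
have [s s0 hs] := iffLR (near0P _) hE.
apply: (ae_spread p0 p1).
  by exists s => // z z0 zs; exact: hs.
apply: ae_imply2 hM (ae_and hH hF) => z uM [eH eF] e.
apply: (can_inj (mulmxK uA)); apply: (can_inj (mulKmx uM)).
rewrite [RHS]mulmxA -eH -e eF scalerA mulrC -qpoch2_rec.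
by rewrite -scalemxAl -scalemxAr mulmxA.
Qed.
End Gauge.

(** * The matrices Lambda *)
Lemma ord2_ind (P : 'I_2 -> Prop) : P 0 -> P 1 -> forall i, P i.
Proof.
move=> P0 P1 [[|[|//]] h]; [move: P0|move: P1]; congr P; exact: val_inj.
Qed.

Section LambdaMatrix.
Variable R : realType.
Local Notation C := (Cplx R).
Variables (q : C).
Hypothesis q1 : 1 < `|q|.

Let q0 : q != 0. Proof. by rewrite -normr_gt0; apply: lt_trans q1; exact: ltr01. Qed.
Let p := q^-1.
Let p0 : p != 0. Proof. by rewrite invr_eq0. Qed.
Let p1 : `|p| < 1. Proof. by rewrite normfV invf_lt1 ?normr_gt0. Qed.
Let pq : p^-1 = q. Proof. exact: invrK. Qed.

(** By [diag_in_fun], the diagonalization chosen in [LambdaM] is immaterial. *)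
Lemma LambdaM_diag_in (V : 'M[C]_2) (d : 'I_2 -> C) z : V \in unitmx ->
  LambdaM q (diag_in V d) z = diag_in V (fun i => Lambda q (d i) z).
Proof.
move=> Vu; rewrite /LambdaM /diagonalization; set S := [set _ | _].
have : S (xget (1%:M, 0) S) by apply: (@xgetPex _ _ S); exists (V, \row_i d i).
case: (xget _ S) => W e [/= Wu BE].
apply: (diag_in_fun (fun a => Lambda q a z) Wu Vu); rewrite BE /diag_in.
by rewrite (_ : \row_i e 0 i = e)//; apply/rowP => i; rewrite mxE.
Qed.

Lemma Theta_q z : z != 0 -> Theta q (q * z) = z * Theta q z.
Proof. by move=> z0; have := Theta_qshift p1 p0 z0; rewrite pq. Qed.

(** The zeros of Theta form the spiral -q^Z. *)
Lemma ae_Theta_neq0 (a : C) : a != 0 -> ae_Cstar (fun z => Theta q (a * z) != 0).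
Proof.
move=> a0; have an : - a^-1 != 0 by rewrite oppr_eq0 invr_eq0.
apply: ae_imply2 (ae_neq 0) (ae_neq_spiral p0 p1 an) => z z0 zn; apply/eqP.
rewrite -pq => /(Theta_eq0 p1 p0 (mulf_neq0 a0 z0))[n e]; apply: (zn n).
by rewrite mulNr -[RHS]mulrN -e mulKf.
Qed.

Lemma ae_Lambda_neq0 (a : C) : a != 0 -> ae_Cstar (fun z => Lambda q a z != 0).
Proof.
move=> a0; have av : a^-1 != 0 by rewrite invr_eq0.
apply: ae_imply2 (ae_Theta_neq0 (oner_neq0 C)) (ae_Theta_neq0 av) => z; rewrite mul1r mulrC => h1 h2.
apply: mulf_neq0; first exact: h1.
by rewrite invr_eq0; exact: h2.
Qed.

Lemma Lambda_q (a z : C) : a != 0 -> z != 0 -> Lambda q a (q * z) = a * Lambda q a z.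
Proof.
move=> a0 z0; have za : z / a != 0 by rewrite mulf_neq0// invr_eq0.
rewrite /Lambda -mulrA (Theta_q z0) (Theta_q za).
move: (Theta q z) (Theta q (z / a)) => x y.
by rewrite !invfM invrK mulrACA (mulrA z) divff// mul1r.
Qed.

Section Fixed.
Variables (V : 'M[C]_2) (d : 'I_2 -> C).
Hypotheses (Vu : V \in unitmx) (d0 : forall i, d i != 0).
Let B := diag_in V d.

Lemma ae_LambdaM_unit : ae_Cstar (fun z => LambdaM q B z \in unitmx).
Proof.
apply: ae_imply2 (ae_Lambda_neq0 (d0 0)) (ae_Lambda_neq0 (d0 1)) => z h0 h1.
rewrite LambdaM_diag_in// diag_in_unit//; apply/forallP; apply: ord2_ind.
  exact: h0.
exact: h1.
Qed.

Lemma LambdaM_q z : z != 0 -> LambdaM q B (q * z) = B *m LambdaM q B z.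
Proof.
move=> z0; rewrite (LambdaM_diag_in _ _ Vu) (LambdaM_diag_in _ _ Vu) (diag_inM _ _ Vu).
by apply: eq_diag_in => i; exact: (Lambda_q (d0 i) z0).
Qed.

End Fixed.
End LambdaMatrix.

Section LambdaShifts.
Variable R : realType.
Local Notation C := (Cplx R).
Variables (q : C).
Hypothesis q1 : 1 < `|q|.
Let q0 : q != 0. Proof. by rewrite -normr_gt0; apply: lt_trans q1; exact: ltr01. Qed.

(** Theta(q^2 x) = q x^2 Theta(x) at x = z / a. *)
Lemma Lambda_qV2 (a z : C) : a != 0 -> z != 0 ->
  Lambda q a z = q * z ^+ 2 * (Lambda q (q ^- 2 * a) z * (a^-1 * a^-1)).
Proof.
move=> a0 z0; rewrite /Lambda.
have x0 : z / a != 0 by rewrite mulf_neq0// invr_eq0.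
have qx0 : q * (z / a) != 0 by rewrite mulf_neq0.
have -> : z / (q ^- 2 * a) = q * (q * (z / a)) by field; rewrite a0.
rewrite (Theta_q q1 qx0) (Theta_q q1 x0).
move: (Theta q z) (Theta q (z / a)) => T S.
rewrite !invfM invrK; set S' := S^-1; field; rewrite a0 z0; exact: q0.
Qed.

Lemma Lambda_shift (t c z : C) : t != 0 -> c != 0 -> z != 0 ->
  Lambda q ((q * t)^-1 * c) z = (t * z)^-1 * (c * Lambda q (t^-1 * c) z).
Proof.
move=> t0 c0 z0; rewrite /Lambda.
have x0 : z / (t^-1 * c) != 0 by rewrite mulf_neq0// invr_eq0 mulf_neq0// invr_eq0.
have -> : z / ((q * t)^-1 * c) = q * (z / (t^-1 * c)) by field; rewrite c0 t0; exact: q0.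
rewrite (Theta_q q1 x0).
move: (Theta q z) (Theta q (z / (t^-1 * c))) => T S.
rewrite !invfM !invrK; set S' := S^-1; field; rewrite z0; exact: t0.
Qed.

Variables (V : 'M[C]_2) (d : 'I_2 -> C).
Hypotheses (Vu : V \in unitmx) (d0 : forall i, d i != 0).

Lemma LambdaM_qV2 z : z != 0 ->
  LambdaM q (diag_in V (fun i => (d i)^-1)) z = (q * z ^+ 2) *:
    (LambdaM q (diag_in V (fun i => q ^- 2 * (d i)^-1)) z *m (diag_in V d *m diag_in V d)).
Proof.
move=> z0; rewrite [LHS](LambdaM_diag_in q (fun i => (d i)^-1) z Vu).
rewrite [in RHS](LambdaM_diag_in q (fun i => q ^- 2 * (d i)^-1) z Vu).
have factor (f g : 'I_2 -> C) (s : C) : (forall i, f i = s * (g i * (d i * d i))) ->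
    diag_in V f = s *: (diag_in V g *m (diag_in V d *m diag_in V d)).
  move=> fg.
  rewrite [X in _ *: (_ *m X)](diag_inM d d Vu).
  rewrite (diag_inM g (fun i => d i * d i) Vu) (diag_inZ V s).
  exact: eq_diag_in fg.
apply: factor => i; have di0 : (d i)^-1 != 0 by rewrite invr_eq0; exact: d0.
rewrite (Lambda_qV2 di0 z0) invrK; reflexivity.
Qed.

Lemma LambdaM_shift t z : t != 0 -> z != 0 ->
  LambdaM q ((q * t)^-1 *: diag_in V d) z = (t * z)^-1 *: (diag_in V d *m LambdaM q (t^-1 *: diag_in V d) z).
Proof.
move=> t0 z0; rewrite (diag_inZ V (q * t)^-1) (diag_inZ V t^-1).
rewrite [LHS](LambdaM_diag_in q (fun i => (q * t)^-1 * d i) z Vu).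
rewrite [in RHS](LambdaM_diag_in q (fun i => t^-1 * d i) z Vu).
have factor (f g : 'I_2 -> C) (s : C) : (forall i, f i = s * (d i * g i)) ->
    diag_in V f = s *: (diag_in V d *m diag_in V g).
  by move=> fg; rewrite (diag_inM _ _ Vu) diag_inZ; apply: eq_diag_in.
by apply: factor => i; exact: (Lambda_shift t0 (d0 i) z0).
Qed.

End LambdaShifts.

(** * Leading terms and the equations of normalized solutions *)
Section Leading.
Variable R : realType.
Local Notation C := (Cplx R).
Implicit Types (A G H Y N : C -> 'M[C]_2) (B : 'M[C]_2).

Lemma regular_id : @regular R id.
Proof.
split=> [k|]; last by apply: near_all => z; exact: cvg_id.
elim: k => [|k _]; first by apply: (@taylor0I _ 1); exact: near0_le1.
apply: (taylorSI (taylor_cst k (1 : C))); apply: near_all => z.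
by rewrite mulr1 add0r.
Qed.

Lemma regularX (n : nat) : regular (fun z : C => z ^+ n).
Proof.
elim: n => [|n IH]; first exact: regular_cst.
apply: regular_ext (regularM regular_id IH); apply: near_all => z.
by rewrite exprS.
Qed.

Lemma leading_exponent_le G (G' : C -> 'M[C]_2) k : mx_regular G -> mx_regular G' -> G' 0 \in unitmx ->
  ~ (\forall z \near (0 : C)^', z ^+ k.+1 *: G z = G' z).
Proof.
move=> rG rG' u h.
suff G0 : G' 0 = 0 by move: u; rewrite G0 unitmxE det0 unitr0.
apply/matrixP => i j; rewrite mxE.
have r1 := regularM (regularX k.+1) (rG i j).
have e : (0 : C) ^+ k.+1 * G 0 i j = G' 0 i j.
  apply: (@eq_of_dnbhs R (fun z => z ^+ k.+1 * G z i j) (fun z => G' z i j) 0).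
  - exact: (regular_cvg r1).
  - exact: (regular_cvg (rG' i j)).
  by apply: dnbhs_imply h => z <-; rewrite mxE.
by rewrite -e expr0n mul0r.
Qed.

(** An equality z^mu G' = z^nu G with mu <> nu would give z^(k+1) G = G' (or the
    symmetric relation), whose value at 0 contradicts the invertibility of G'(0). *)
Lemma leading_unique A G mu nu B : leading_at_0 A mu B -> B \in unitmx ->
  mx_regular G -> G 0 \in unitmx -> (\forall z \near (0 : C)^', A z = z ^ nu *: G z) ->
  mu = nu /\ B = G 0.
Proof.
move=> [G' [aG' G'0 hG']] Bu rG Gu hG.
have rG' : mx_regular G' by move=> i j; apply: analytic_regular; exact: aG'.
have Gu' : G' 0 \in unitmx by rewrite G'0.
have h : \forall z \near (0 : C)^', z != 0 /\ z ^ mu *: G' z = z ^ nu *: G z.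
  apply: dnbhs_imply2 (dnbhs_imply2 (fun z a b => conj a b) hG' hG) (_ : \forall z \near (0 : C)^', z != 0).
    by move=> z [<- <-].
  by apply/dnbhsP; apply: near_all.
have [lt|lt|e] := ltgtP mu nu.
- exfalso; apply: (leading_exponent_le (k := `|nu - mu|.-1) rG rG' Gu').
  apply: dnbhs_imply h => z [z0 e].
  apply: (scalerI (expfz_neq0 mu z0)); rewrite e scalerA; congr (_ *: _).
  by rewrite exprnP -expfzDr// int_lt_addSn.
- exfalso; apply: (leading_exponent_le (k := `|mu - nu|.-1) rG' rG Gu).
  apply: dnbhs_imply h => z [z0 e].
  apply: (scalerI (expfz_neq0 nu z0)); rewrite -e scalerA; congr (_ *: _).
  by rewrite exprnP -expfzDr// int_lt_addSn.
- split=> //; rewrite -G'0; apply/matrixP => i j.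
  apply: (@eq_of_dnbhs R (fun z => G' z i j) (fun z => G z i j) 0).
  + exact: (regular_cvg (rG' i j)).
  + exact: (regular_cvg (rG i j)).
  apply: dnbhs_imply h => z [z0]; rewrite e => /(scalerI (expfz_neq0 nu z0)) -> //.
Qed.

Section Solutions.
Variable q : C.
Hypothesis q1 : 1 < `|q|.
Let q0 : q != 0. Proof. by rewrite -normr_gt0; apply: lt_trans q1; exact: ltr01. Qed.
Let p := q^-1.
Let p0 : p != 0. Proof. by rewrite invr_eq0. Qed.

(** The exponent and the leading matrix of a normalized solution are determined by
    the system, so they can be read off any factorization of A at 0. *)
Lemma normalized_solution_0E A Y G nu : normalized_solution_0 q A Y ->
  mx_regular G -> G 0 \in unitmx -> (\forall z \near (0 : C)^', A z = z ^ nu *: G z) ->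
  exists H, [/\ mx_regular H, H 0 = 1%:M, solution q A Y &
    mero_eq Y (fun z => Theta q z ^ nu *: (H z *m LambdaM q (G 0) z))].
Proof.
move=> [mu [B [H [[lA Bu _] [aH H0 sY eY]]]]] rG Gu hG.
have [emu eB] := leading_unique lA Bu rG Gu hG.
rewrite -emu -eB; exists H; split; [|exact: H0|exact: sY|exact: eY].
by move=> i j; apply: analytic_regular; exact: aH.
Qed.

Lemma normalized_solution_ooE A Y G nu : normalized_solution_oo q A Y ->
  mx_regular G -> G 0 \in unitmx -> (\forall w \near (0 : C)^', A w^-1 = w ^ (- nu) *: G w) ->
  exists H, [/\ mx_regular H, H 0 = 1%:M, solution q A Y &
    mero_eq Y (fun z => Theta q z ^ nu *: (H z^-1 *m LambdaM q (G 0) z))].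
Proof.
move=> [mu [B [H [[lA Bu _] [aH H0 sY eY]]]]] rG Gu hG.
have [/oppr_inj emu eB] := leading_unique lA Bu rG Gu hG.
rewrite -emu -eB; exists H; split; [|exact: H0|exact: sY|exact: eY].
by move=> i j; apply: analytic_regular; exact: aH.
Qed.

(** The functional equations of Theta and LambdaM turn the system for Y into one
    for H. It is written at p z, the contracting direction at the origin. *)
Lemma solution_equation N Y H mu V (d : 'I_2 -> C) :
  let B := diag_in V d in
  V \in unitmx -> (forall i, d i != 0) ->
  ae_Cstar (fun z => N z \in unitmx) ->
  solution q (fun z => invmx (N (q * z))) Y ->
  mero_eq Y (fun z => Theta q z ^ mu *: (H z *m LambdaM q B z)) ->
  ae_Cstar (fun z => H (p * z) = (p * z) ^ mu *: (N z *m H z *m B)).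
Proof.
move=> B Vu d0 uN [_ _ sY] eY.
have Lu := ae_scale p0 (ae_LambdaM_unit q1 Vu d0).
have Tn := ae_scale p0 (ae_Theta_neq0 q1 (oner_neq0 C)).
apply: ae_imply2 (ae_and (ae_neq 0) (ae_and uN (ae_and Lu Tn)))
  (ae_and (ae_scale p0 sY) (ae_and eY (ae_scale p0 eY))).
move=> z [z0 [uNz [uL Tz]]] [e1 [e2 e3]].
have pz0 : p * z != 0 by rewrite mulf_neq0.
have qpz : q * (p * z) = z by rewrite mulrA divff// mul1r.
have T1 := Theta_q q1 pz0; have L1 := LambdaM_q q1 Vu d0 pz0.
rewrite mul1r in Tz; rewrite qpz in T1 L1 e1.
rewrite e3 e2 L1 T1 in e1.
move: uL Tz e1 {e2 e3 L1 T1}; rewrite -/B; move: (LambdaM q B (p * z)) (Theta q (p * z)) => L T uL T0 e1.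
have {}e1 := congr1 (mulmx (N z)) e1; rewrite mulKVmx// -!scalemxAr expfzMl in e1.
apply: (can_inj (mulmxK uL)); apply: (scalerI (expfz_neq0 mu T0)).
by rewrite -e1 mulrC -scalerA -scalemxAl !mulmxA.
Qed.

End Solutions.
End Leading.

(** * The connection formula *)
Section ConnectionFormula.
Variable R : realType.
Local Notation C := (Cplx R).

Lemma mx_regularD m n (G H : C -> 'M[C]_(m, n)) :
  mx_regular G -> mx_regular H -> mx_regular (fun z => G z + H z).
Proof.
move=> rG rH i j; apply: regular_ext (regularD (rG i j) (rH i j)).
by apply: near_all => z; rewrite mxE.
Qed.

Lemma mx_regularZ m n (f : C -> C) (G : C -> 'M[C]_(m, n)) :
  regular f -> mx_regular G -> mx_regular (fun z => f z *: G z).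
Proof.
move=> rf rG i j; apply: regular_ext (regularM rf (rG i j)).
by apply: near_all => z; rewrite mxE.
Qed.

Lemma near0_neq (a : C) : a != 0 -> \forall z \near (0 : C), z != a.
Proof.
move=> a0; have h : 0 < `|a| by rewrite normr_gt0.
by apply: near_imply (near_ball0 h) => z za; apply: contraTneq za => ->; rewrite ltxx.
Qed.

Lemma invmx_scale n (a : C) (A : 'M[C]_n) : a != 0 -> A \in unitmx ->
  invmx (a *: A) = a^-1 *: invmx A.
Proof.
by move=> a0 Au; rewrite invmxZ// unitmxZ ?unitfE.
Qed.

Lemma mul_scale2 m n k l (a b : C) (A : 'M[C]_(m, n)) (B : 'M[C]_(n, k)) (D : 'M[C]_(k, l)) :
  (a *: A) *m B *m (b *: D) = (a * b) *: (A *m B *m D).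
Proof. by rewrite -scalemxAr -!scalemxAl scalerA mulrC. Qed.

Lemma quadratic_pencil_oo n (a w : C) (X Y Z : 'M[C]_n) : w != 0 ->
  X + (a / w) *: Y + (a / w) ^+ 2 *: Z =
  w ^- 2 *: (w ^+ 2 *: X + w *: (a *: Y) + a ^+ 2 *: Z).
Proof.
move=> w0; rewrite 2!(scalerDr (w ^- 2)) !scalerA.
have -> : w ^- 2 * w ^+ 2 = 1 by rewrite mulVf// expf_neq0.
have -> : w ^- 2 * (w * a) = a / w by field.
have -> : w ^- 2 * a ^+ 2 = (a / w) ^+ 2 by field.
by rewrite scale1r.
Qed.

Variables (q t : C).
Hypotheses (q1 : 1 < `|q|) (t0 : t != 0).
Let q0 : q != 0. Proof. by rewrite -normr_gt0; apply: lt_trans q1; exact: ltr01. Qed.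
Let p := q^-1.
Let p0 : p != 0. Proof. by rewrite invr_eq0. Qed.
Let p1 : `|p| < 1. Proof. by rewrite normfV invf_lt1 ?normr_gt0. Qed.

Variables (N : C -> 'M[C]_2) (V A1 B0 K : 'M[C]_2) (b k : 'I_2 -> C).
Hypotheses (Vu : V \in unitmx) (b0 : forall i, b i != 0) (k0 : forall i, k i != 0).
Hypotheses (B0E : B0 = diag_in V b) (KE : K = diag_in 1%:M k).
Let u1 : (1%:M : 'M[C]_2) \in unitmx. Proof. exact: unitmx1. Qed.
Let B0u : B0 \in unitmx. Proof. by rewrite B0E (diag_in_unit _ Vu); apply/forallP. Qed.
Let Ku : K \in unitmx. Proof. by rewrite KE (diag_in_unit _ u1); apply/forallP. Qed.

(** [D] is the polynomial matrix of the second system; [Doo w] = w^2 D(q / w) is its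
    polynomial form in the coordinate w = 1 / z, after z |-> q z. *)
Let D z := t *: B0 + z *: A1 + z ^+ 2 *: K.
Let Doo w := w ^+ 2 *: (t *: B0) + w *: (q *: A1) + q ^+ 2 *: K.
Hypothesis hD : forall z, z != 0 -> z != 1 -> z != t -> ((z - 1) * (z - t)) *: N z = D z.
Hypothesis Du : ae_Cstar (fun z => D z \in unitmx).
Hypothesis b_nonres : forall i j n, (b i)^-1 / (b j)^-1 * p ^+ n.+1 != 1.
Hypothesis k_nonres : forall i j n, k i / k j * p ^+ n.+1 != 1.

Let Dq_regular : mx_regular (fun z => D (q * z)).
Proof.
apply: mx_regularD; first apply: mx_regularD.
- exact: mx_regular_cst.
- apply: mx_regularZ; last exact: mx_regular_cst.
  exact: (regularM (regular_cst q) (@regular_id R)).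
- apply: mx_regularZ; last exact: mx_regular_cst.
  have h := regularM (regular_cst q) (@regular_id R).
  exact: (regularM h h).
Qed.

Let Doo_regular : mx_regular Doo.
Proof.
apply: mx_regularD; first apply: mx_regularD.
- apply: mx_regularZ; [exact: regularX|exact: mx_regular_cst].
- apply: mx_regularZ; [exact: regular_id|exact: mx_regular_cst].
- exact: mx_regular_cst.
Qed.

Let Dq_at0 : D (q * 0) = t *: B0.
Proof. by rewrite /D mulr0 expr0n (scale0r A1) (scale0r K) !addr0. Qed.

Let Doo_at0 : Doo 0 = q ^+ 2 *: K.
Proof. by rewrite /Doo expr0n (scale0r (t *: B0)) (scale0r (q *: A1)) !add0r. Qed.

Let Dq_unit0 : D (q * 0) \in unitmx.
Proof. by rewrite Dq_at0 (unitmxZ B0) ?B0u// unitfE. Qed.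

Let Doo_unit0 : Doo 0 \in unitmx.
Proof. by rewrite Doo_at0 (unitmxZ K) ?Ku// unitfE; exact: expf_neq0. Qed.

Let N_of_D z : z != 0 -> z != 1 -> z != t -> D z \in unitmx ->
  N z \in unitmx /\ invmx (N z) = ((z - 1) * (z - t)) *: invmx (D z).
Proof.
move=> z0 z1 zt uD; have s0 : (z - 1) * (z - t) != 0 by rewrite mulf_neq0// subr_eq0.
have e : N z = ((z - 1) * (z - t))^-1 *: D z by rewrite -hD// scalerA mulVf// scale1r.
have si : ((z - 1) * (z - t))^-1 != 0 by rewrite invr_eq0.
by rewrite e unitmxZ ?unitfE// uD invmx_scale// invrK.
Qed.

Let sN z := ((z - 1) * (z - t)) *: N z.

Let near0_good : \forall z \near (0 : C)^', [/\ q * z != 0, q * z != 1, q * z != t & D (q * z) \in unitmx].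
Proof.
have a1 : q^-1 != 0 by rewrite invr_eq0.
have a2 : q^-1 * t != 0 by rewrite mulf_neq0.
apply/dnbhsP; apply: near_imply2 (near_imply2 (fun z a b => conj a b) (near0_neq a1) (near0_neq a2))
  (near_unitmx Dq_regular Dq_unit0).
move=> z [z1 z2] uD z0; split=> //; first by rewrite mulf_neq0.
- by apply: contra z1 => /eqP e; rewrite -(mulKf q0 z) e mulr1.
- by apply: contra z2 => /eqP e; rewrite -(mulKf q0 z) e.
Qed.

Let Doo_D w : w != 0 -> D (q * w^-1) = w ^- 2 *: Doo w.
Proof. exact: quadratic_pencil_oo. Qed.

Let nearoo_good : \forall w \near (0 : C)^',
  [/\ w != 0, Doo w \in unitmx, q * w^-1 != 0, q * w^-1 != 1 & q * w^-1 != t].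
Proof.
have a2 : q / t != 0 by rewrite mulf_neq0// invr_eq0.
apply/dnbhsP; apply: near_imply2 (near_imply2 (fun z a b => conj a b) (near0_neq q0) (near0_neq a2))
  (near_unitmx Doo_regular Doo_unit0).
move=> w [w1 w2] uD w0; split=> //; first by rewrite mulf_neq0// invr_eq0.
- by apply: contra w1 => /eqP e; rewrite -(mulfVK w0 q) e mul1r.
- by apply: contra w2 => /eqP e; rewrite -(mulfVK w0 q) e mulrC mulKf.
Qed.

Lemma leading_N_0 : \forall z \near (0 : C)^', invmx (N (q * z)) =
   z ^ 0 *: (((q * z - 1) * (q * z - t)) *: invmx (D (q * z))).
Proof.
apply: dnbhs_imply near0_good => z [h1 h2 h3 h4]; rewrite expr0z scale1r.
by case: (N_of_D h1 h2 h3 h4).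
Qed.

Lemma leading_sN_0 : \forall z \near (0 : C)^', invmx (sN (q * z)) = z ^ 0 *: invmx (D (q * z)).
Proof.
apply: dnbhs_imply near0_good => z [h1 h2 h3 h4]; rewrite expr0z scale1r.
by rewrite /sN hD.
Qed.

Lemma leading_N_oo : \forall w \near (0 : C)^', invmx (N (q * w^-1)) =
   w ^ (- 0) *: (((q - w) * (q - t * w)) *: invmx (Doo w)).
Proof.
apply: dnbhs_imply nearoo_good => w [w0 uD h1 h2 h3]; rewrite oppr0 expr0z scale1r.
have w2 : w ^- 2 != 0 by rewrite invr_eq0 expf_neq0.
have uD' : D (q * w^-1) \in unitmx by rewrite (Doo_D w0) (unitmxZ (Doo w)) ?uD// unitfE.
have [_ ->] := N_of_D h1 h2 h3 uD'; rewrite (Doo_D w0) (invmx_scale w2 uD) scalerA.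
by congr (_ *: _); field.
Qed.

Lemma leading_sN_oo : \forall w \near (0 : C)^', invmx (sN (q * w^-1)) = w ^ (- (- 2)) *: invmx (Doo w).
Proof.
apply: dnbhs_imply nearoo_good => w [w0 uD h1 h2 h3].
have w2 : w ^- 2 != 0 by rewrite invr_eq0 expf_neq0.
by rewrite /sN (hD h1 h2 h3) (Doo_D w0) (invmx_scale w2 uD) invrK opprK.
Qed.

Let N_unit : ae_Cstar (fun z => N z \in unitmx).
Proof.
apply: ae_imply2 (ae_and (ae_neq 0) (ae_and (ae_neq 1) (ae_neq t))) Du => z [z0 [z1 zt]] uD.
by case: (N_of_D z0 z1 zt uD).
Qed.

Let sN_unit : ae_Cstar (fun z => sN z \in unitmx).
Proof.
apply: ae_imply2 (ae_and (ae_neq 0) (ae_and (ae_neq 1) (ae_neq t))) Du => z [z0 [z1 zt]] uD.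
by rewrite /sN (hD z0 z1 zt).
Qed.

Let B0iE : invmx B0 = diag_in V (fun i => (b i)^-1).
Proof. rewrite B0E (diag_inV Vu b0); reflexivity. Qed.

Let tB0iE : t^-1 *: invmx B0 = diag_in V (fun i => t^-1 * (b i)^-1).
Proof. rewrite B0iE diag_inZ; reflexivity. Qed.

Let KiE : invmx K = diag_in 1%:M (fun i => (k i)^-1).
Proof. rewrite KE (diag_inV u1 k0); reflexivity. Qed.

Let qKiE : q ^- 2 *: invmx K = diag_in 1%:M (fun i => q ^- 2 * (k i)^-1).
Proof. rewrite KiE diag_inZ; reflexivity. Qed.

Let bi0 i : (b i)^-1 != 0. Proof. by rewrite invr_eq0. Qed.
Let tbi0 i : t^-1 * (b i)^-1 != 0. Proof. by rewrite mulf_neq0// invr_eq0. Qed.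
Let ki0 i : (k i)^-1 != 0. Proof. by rewrite invr_eq0. Qed.
Let qki0 i : q ^- 2 * (k i)^-1 != 0.
Proof. by rewrite mulf_neq0// invr_eq0// expf_neq0. Qed.

(** At 0 the two systems differ by (z - 1) (z - t) = t (1 - z) (1 - z / t); the
    factor t is absorbed by the leading matrix t^-1 B0^-1. *)
Lemma compare_solutions_0 Y0 W0 :
  normalized_solution_0 q (fun z => invmx (N (q * z))) Y0 ->
  normalized_solution_0 q (fun z => invmx (sN (q * z))) W0 ->
  exists H F : C -> 'M[C]_2,
    [/\ mero_eq Y0 (fun z => H z *m LambdaM q (invmx B0) z),
        mero_eq W0 (fun z => F z *m LambdaM q (t^-1 *: invmx B0) z) &
        ae_Cstar (fun z => (qpoch p z * qpoch p (t^-1 * z)) *: F z = H z)].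
Proof.
move=> sY sW.
have rDi : mx_regular (fun z => invmx (D (q * z))) by exact: mx_regularV Dq_regular Dq_unit0.
have rG : mx_regular (fun z => ((q * z - 1) * (q * z - t)) *: invmx (D (q * z))).
  apply: mx_regularZ; last exact: rDi.
  have h (a : C) : regular (fun z => q * z - a).
    exact: (regularD (regularM (regular_cst q) (@regular_id R)) (regular_cst (- a))).
  exact: (regularM (h 1) (h t)).
have eG : ((q * 0 - 1) * (q * 0 - t)) *: invmx (D (q * 0)) = invmx B0.
  rewrite Dq_at0 (invmx_scale t0 B0u) scalerA mulr0 !sub0r mulrNN mul1r divff//.
  by rewrite scale1r.
have eG2 : invmx (D (q * 0)) = t^-1 *: invmx B0 by rewrite Dq_at0 (invmx_scale t0 B0u).
have uG : ((q * 0 - 1) * (q * 0 - t)) *: invmx (D (q * 0)) \in unitmx by rewrite eG unitmx_inv B0u.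
have uG2 : invmx (D (q * 0)) \in unitmx by rewrite unitmx_inv Dq_unit0.
have [H [rH H0 soY eY]] := normalized_solution_0E sY rG uG leading_N_0.
have [F [rF F0 soW eW]] := normalized_solution_0E sW rDi uG2 leading_sN_0.
rewrite eG in eY; rewrite eG2 in eW.
have eqH : ae_Cstar (fun z => H (p * z) = N z *m H z *m invmx B0).
  have e := eY; rewrite B0iE in e.
  have := solution_equation q1 Vu bi0 N_unit soY e.
  by apply: ae_imply => z; rewrite expr0z scale1r -B0iE.
have eqF : ae_Cstar (fun z => F (p * z) = ((1 - 1 * z) * (1 - t^-1 * z)) *: (N z *m F z *m invmx B0)).
  have e := eW; rewrite tB0iE in e.
  have := solution_equation q1 Vu tbi0 sN_unit soW e.
  apply: ae_imply => z ->; rewrite expr0z scale1r -tB0iE /sN mul_scale2; congr (_ *: _).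
  by field.
exists H, F; split.
- by apply: ae_imply eY => z ->; rewrite expr0z scale1r.
- by apply: ae_imply eW => z ->; rewrite expr0z scale1r.
rewrite B0iE in eqH eqF.
have := gauge_qpoch p0 p1 rH rF H0 F0 Vu bi0 b_nonres N_unit eqH eqF.
by apply: ae_imply => z; rewrite mul1r.
Qed.

Let g w := (1 - p * w) * (1 - p * t * w).

Let g_neq0 : ae_Cstar (fun w => g w != 0).
Proof.
apply: ae_imply2 (ae_neq p^-1) (ae_neq (p * t)^-1) => w w1 w2.
have pt0 : p * t != 0 by rewrite mulf_neq0.
rewrite mulf_neq0// subr_eq0 eq_sym.
  by apply: contra w1 => /eqP e; rewrite -[w](mulKf p0) e mulr1.
by apply: contra w2 => /eqP e; rewrite -[w](mulKf pt0) e mulr1.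
Qed.

(** At infinity, in the coordinate w = 1 / z, the roles are exchanged: the solution
    of the second system satisfies the untwisted equation and that of the first
    one the equation twisted by (1 - p w) (1 - p t w). *)
Lemma compare_solutions_oo Yoo Woo :
  normalized_solution_oo q (fun z => invmx (N (q * z))) Yoo ->
  normalized_solution_oo q (fun z => invmx (sN (q * z))) Woo ->
  exists H F : C -> 'M[C]_2,
    [/\ mero_eq Yoo (fun z => H z *m LambdaM q (invmx K) z),
        mero_eq Woo (fun z => Theta q z ^- 2 *: (F z *m LambdaM q (q ^- 2 *: invmx K) z)) &
        ae_Cstar (fun z => (qpoch p (p * z^-1) * qpoch p (p * t * z^-1)) *: H z = F z)].
Proof.
move=> sY sW.
have rDi : mx_regular (fun w => invmx (Doo w)) by exact: mx_regularV Doo_regular Doo_unit0.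
have rG : mx_regular (fun w => ((q - w) * (q - t * w)) *: invmx (Doo w)).
  apply: mx_regularZ; last exact: rDi.
  have h (a : C) : regular (fun w => q - a * w).
    have := regularD (regular_cst q) (regularM (regular_cst (- a)) (@regular_id R)).
    by apply: regular_ext; apply: near_all => w; rewrite mulNr.
  have h1 : regular (fun w => q - w).
    by apply: regular_ext (h 1); apply: near_all => w; rewrite mul1r.
  exact: (regularM h1 (h t)).
have q20 : q ^+ 2 != 0 by rewrite expf_neq0.
have eG2 : invmx (Doo 0) = q ^- 2 *: invmx K by rewrite Doo_at0 (invmx_scale q20 Ku).
have eG : ((q - 0) * (q - t * 0)) *: invmx (Doo 0) = invmx K.
  by rewrite eG2 scalerA mulr0 !subr0 -expr2 divff// scale1r.
have uG : ((q - 0) * (q - t * 0)) *: invmx (Doo 0) \in unitmx by rewrite eG unitmx_inv Ku.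
have uG2 : invmx (Doo 0) \in unitmx by rewrite unitmx_inv Doo_unit0.
have [H [rH H0 soY eY]] := normalized_solution_ooE sY rG uG leading_N_oo.
have [F [rF F0 soW eW]] := normalized_solution_ooE sW rDi uG2 leading_sN_oo.
rewrite eG in eY; rewrite eG2 in eW.
have pinv w : w != 0 -> p * (p * w)^-1 = w^-1.
  by move=> w0; rewrite invfM mulrA divff// mul1r.
have eqH : ae_Cstar (fun w => H w = N (p * w)^-1 *m H (p * w) *m invmx K).
  have e := eY; rewrite KiE in e.
  have h := solution_equation (H := fun z => H z^-1) q1 u1 ki0 N_unit soY e.
  apply: ae_imply2 (ae_neq 0) (ae_scale p0 (ae_inv h)) => w w0.
  by rewrite (pinv w w0) !invrK expr0z scale1r -KiE.
have eqF : ae_Cstar (fun w => F w = g w *: (N (p * w)^-1 *m F (p * w) *m invmx K)).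
  have e := eW; rewrite qKiE in e.
  have h := solution_equation (H := fun z => F z^-1) q1 u1 qki0 sN_unit soW e.
  apply: ae_imply2 (ae_neq 0) (ae_scale p0 (ae_inv h)) => w w0.
  rewrite (pinv w w0) !invrK -qKiE => ->; rewrite /sN mul_scale2 scalerA; congr (_ *: _).
  by rewrite /g /p -exprnN; field; apply/andP; split; [exact: q0|exact: w0].
pose M w := (g w)^-1 *: invmx (N (p * w)^-1).
have Nu := ae_scale p0 (ae_inv N_unit).
have Mu : ae_Cstar (fun w => M w \in unitmx).
  apply: ae_imply2 g_neq0 Nu => w gw uN.
  rewrite /M (unitmxZ (invmx _)); first by rewrite unitmx_inv.
  by rewrite unitfE invr_eq0.
have eqF' : ae_Cstar (fun w => F (p * w) = M w *m F w *m K).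
  apply: ae_imply2 (ae_and g_neq0 Nu) eqF => w [gw uN] ->.
  rewrite /M -scalemxAr -!scalemxAl scalerA mulfV// scale1r !mulmxA mulVmx// mul1mx.
  by rewrite mulmxKV.
have eqH' : ae_Cstar (fun w => H (p * w) = g w *: (M w *m H w *m K)).
  apply: ae_imply2 (ae_and g_neq0 Nu) eqH => w [gw uN] ->.
  rewrite /M -!scalemxAl scalerA mulfV// scale1r !mulmxA mulVmx// mul1mx.
  by rewrite mulmxKV.
exists (fun z => H z^-1), (fun z => F z^-1); split.
- by apply: ae_imply eY => z ->; rewrite expr0z scale1r.
- by apply: ae_imply eW => z ->; rewrite exprnN.
rewrite KE in eqH' eqF'.
exact: (ae_inv (gauge_qpoch p0 p1 rF rH F0 H0 u1 k0 k_nonres Mu eqF' eqH')).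
Qed.

(** With th = Theta^-2, e0 and ei the products of [compare_solutions_0] and
    [compare_solutions_oo], s = q z^2, K' = K^2 and a = q, this expresses Q by P. *)
Lemma connection_algebra n (H0 F0 Hi Fi L0 Lt L1 L2 K' P Q : 'M[C]_n) (e0 ei th c s a : C) :
  Hi *m L1 \in unitmx -> th *: (Fi *m L2) \in unitmx -> L0 \in unitmx ->
  P = invmx (Hi *m L1) *m (H0 *m L0) -> Q = invmx (th *: (Fi *m L2)) *m (F0 *m Lt) ->
  e0 *: F0 = H0 -> ei *: Hi = Fi -> L1 = s *: (L2 *m K') -> th * ei * c * a * e0 = s -> s != 0 ->
  Q = c *: (K' *m P *m invmx L0 *m (a *: Lt)).
Proof.
move=> uY uW uL eP -> eF eH eL es s0.
have PX : Hi *m L1 *m P *m invmx L0 = H0.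
  by rewrite eP !mulmxA (mulmxV uY) mul1mx (mulmxK uL).
have LK : L2 *m K' = s^-1 *: L1 by rewrite eL scalerA mulVf// scale1r.
have core : Hi *m L2 *m (K' *m P *m invmx L0 *m Lt) = (s^-1 * e0) *: (F0 *m Lt).
  rewrite -scalerA scalemxAl eF -PX !mulmxA -(mulmxA Hi L2 K') LK.
  by rewrite -scalemxAr -!scalemxAl.
apply: (can_inj (mulKmx uW)); rewrite mulKVmx//.
rewrite -eH -!scalemxAl -!scalemxAr core !scalerA.
rewrite (_ : _ * _ = (th * ei * c * a * e0) / s); last by ring.
by rewrite es divff// scale1r.
Qed.

Lemma normalized_solution_oo_unit A Y : normalized_solution_oo q A Y ->
  ae_Cstar (fun z => Y z \in unitmx).
Proof. by case=> mu [B [H [_ [_ _ [_ uY _] _]]]]. Qed.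

Lemma infprod_qpoch : infprod (fun n => (1 - q ^- n.+1) ^+ 2) = qpoch p p ^+ 2.
Proof.
apply: norm_cvg_lim.
have -> : (fun m : nat => \prod_(0 <= n < m) (1 - q ^- n.+1) ^+ 2) = (fun m => qfact p m * qfact p m).
  apply/funext => m; rewrite /qfact -big_split; apply: eq_bigr => n _ /=.
  by rewrite expr2 /p exprVn.
rewrite expr2; apply: cvgM; exact: (qfact_cvg p1).
Qed.

(** The triple product at -q z. The products that compare the solutions at 0 and
    at infinity are the two halves of such a theta function. *)
Lemma Theta_qpoch z : z != 0 ->
  Theta q (- (q * z)) = qpoch p p * (qpoch p z * qpoch p (p * z^-1)).
Proof.
move=> z0; have y0 : - (q * z) != 0 by rewrite oppr_eq0 mulf_neq0.
have e1 : - (p * - (q * z)) = z by rewrite /p; field.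
have e2 : - (- (q * z))^-1 = p * z^-1 by rewrite invrN opprK invfM.
have := jacobi_triple p1 p0 y0; rewrite e1 e2 invrK -mulrA; exact.
Qed.

Definition connection_factor (u z : C) : C :=
  Theta q (q * z) ^+ 2 * infprod (fun n => (1 - q ^- n.+1) ^+ 2) /
    (Theta q (- (q * z)) * Theta q (- (q * z) / u)).

(** Up to the scalars of the two comparison lemmas, W0 and Woo are Y0 and Yoo with
    other Lambda factors. The quotient of the Lambda factors at infinity is
    q z^2 K^2, by [LambdaM_qV2]; z^2 Theta(z)^2 = Theta(q z)^2 and
    [Theta_qpoch] give the scalar factor. *)
Lemma connection_formula P Q : Birkhoff_matrix_inv q N P -> Birkhoff_matrix_inv q sN Q ->
  mero_eq Q (fun z => connection_factor t z *: (K *m K *m P z *m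
      invmx (LambdaM q (invmx B0) z) *m (q *: LambdaM q (t^-1 *: invmx B0) z))).
Proof.
move=> [Y0 [Yoo [nY0 nYoo eP]]] [W0 [Woo [nW0 nWoo eQ]]].
have [H0 [F0 [eY0 eW0 e0]]] := compare_solutions_0 nY0 nW0.
have [Hi [Fi [eYi eWi ei]]] := compare_solutions_oo nYoo nWoo.
have uY := normalized_solution_oo_unit nYoo; have uW := normalized_solution_oo_unit nWoo.
have uL : ae_Cstar (fun z => LambdaM q (invmx B0) z \in unitmx).
  rewrite B0iE; exact: (ae_LambdaM_unit q1 Vu bi0).
have tv0 : - (q / t) != 0 by rewrite oppr_eq0 mulf_neq0// invr_eq0.
have nq0 : - q != 0 by rewrite oppr_eq0.
have T1 := ae_Theta_neq0 q1 (oner_neq0 C).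
have T2 := ae_Theta_neq0 q1 nq0; have T3 := ae_Theta_neq0 q1 tv0.
apply: ae_imply2 (ae_and (ae_and eP eQ) (ae_and (ae_and eY0 eW0) (ae_and eYi eWi)))
  (ae_and (ae_and (ae_and uY uW) (ae_and uL (ae_neq 0))) (ae_and (ae_and e0 ei) (ae_and T1 (ae_and T2 T3)))).
move=> z [[-> ->] [[-> ->] [eYz eWz]]] [[[uYz uWz] [uLz z0]] [[e0z eiz] [T1z [T2z T3z]]]].
rewrite {}eYz in uYz *; rewrite {}eWz in uWz *.
have qz0 : q * z ^+ 2 != 0 by rewrite mulf_neq0 ?expf_neq0.
apply: (connection_algebra (s := q * z ^+ 2) uYz uWz uLz erefl erefl e0z eiz) => //.
- rewrite qKiE KiE KE; exact: (LambdaM_qV2 q1 u1 k0 z0).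
- rewrite /connection_factor infprod_qpoch.
  have zt0 : t^-1 * z != 0 by rewrite mulf_neq0// invr_eq0.
  have et : - (q * z) / t = - (q * (t^-1 * z)) by field; exact: t0.
  have es : p * (t^-1 * z)^-1 = p * t * z^-1 by rewrite invfM invrK mulrA.
  rewrite et; rewrite mul1r in T1z; rewrite mulNr in T2z.
  rewrite mulNr -mulrA in T3z.
  move: T2z T3z; rewrite (Theta_qpoch z0) (Theta_qpoch zt0) es (Theta_q q1 z0).
  have Ep := qpoch_p_neq0 p1.
  move: T1z Ep.
  move: (Theta q z) (qpoch p p) (qpoch p z) (qpoch p (t^-1 * z)) (qpoch p (p * z^-1)) (qpoch p (p * t * z^-1)).
  move=> T E a a' c c' T0 E0; rewrite !mulf_eq0 !negb_or => /and3P[_ a0 c0] /and3P[_ a'0 c'0].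
  field; do ?[apply/andP; split]; assumption.
Qed.

End ConnectionFormula.

(** * Pseudo-constancy *)
Section PseudoConstancy.
Variable R : realType.
Local Notation C := (Cplx R).

Lemma norm_cexp (x : C) : `|cexp x| = Complex (expR (complex.Re x)) 0 :> C.
Proof.
rewrite normc_def /cexp /= !exprMn -mulrDr cos2Dsin2 mulr1 sqrtr_sqr ger0_norm ?expR_ge0//.

Qed.

Lemma norm_qpow_gt1 (l : C) (s : R) : 1 < `|cexp l| -> 0 < s -> 1 < `|qpow l s|.
Proof.
have one : 1 = Complex 1 0 :> C by [].
rewrite /qpow !norm_cexp one !ltcR !expR_gt1 => l0 s0.
have -> : complex.Re ((Complex s 0 : C) * l) = s * complex.Re l.
  by case: l l0 => a b /= _; rewrite mul0r subr0.
exact: mulr_gt0.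
Qed.

(** Q depends on P through an injective linear map f, and the change t |-> q t acts
    on the other factors as multiplication of P by -t^-2 B^-1. *)
Lemma shift_equivalence n (K' X L L' B P1 P2 Q1 Q2 : 'M[C]_n) (c c' a t z : C) :
  K' \in unitmx -> X \in unitmx -> L \in unitmx -> B \in unitmx ->
  c != 0 -> a != 0 -> t != 0 -> z != 0 ->
  Q1 = c *: (K' *m P1 *m X *m (a *: L)) -> Q2 = c' *: (K' *m P2 *m X *m (a *: L')) ->
  c' = - (z / t) * c -> L' = (t * z)^-1 *: (invmx B *m L) -> X *m invmx B = invmx B *m X ->
  Q2 = Q1 <-> P2 = - (P1 *m (t ^+ 2 *: B)).
Proof.
move=> uK uX uL uB c0 a0 t0 z0 -> -> -> -> XB.
pose f P := (c * a) *: (K' *m P *m X *m L).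
have fI : injective f.
  have ca0 : c * a != 0 by rewrite mulf_neq0.
  move=> P P' /(scalerI ca0)/(can_inj (mulmxK uL))/(can_inj (mulmxK uX)).
  exact: (can_inj (mulKmx uK)).
have -> : c *: (K' *m P1 *m X *m (a *: L)) = f P1 by rewrite -scalemxAr scalerA.
have -> : (- (z / t) * c) *: (K' *m P2 *m X *m (a *: ((t * z)^-1 *: (invmx B *m L)))) =
    f (- t ^- 2 *: (P2 *m invmx B)).
  rewrite /f -!scalemxAr -!scalemxAl !scalerA; congr (_ *: _).
    by field; rewrite z0 t0.
  by rewrite !mulmxA -(mulmxA (K' *m P2) X (invmx B)) XB !mulmxA.
have t2 : t ^+ 2 != 0 by rewrite expf_neq0.
split=> [/fI e|->]; last congr f.
  by rewrite -e -scalemxAr -scalemxAl scaleNr scalerN opprK scalerA mulfV// scale1r mulmxKV.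
by rewrite mulNmx -scalemxAr -scalemxAl mulmxK// scaleNr scalerN opprK scalerA mulVf// scale1r.
Qed.

Variables (q t : C).
Hypotheses (q1 : 1 < `|q|) (t0 : t != 0).
Let q0 : q != 0. Proof. by rewrite -normr_gt0; apply: lt_trans q1; exact: ltr01. Qed.
Let p := q^-1.
Let p0 : p != 0. Proof. by rewrite invr_eq0. Qed.
Let p1 : `|p| < 1. Proof. by rewrite normfV invf_lt1 ?normr_gt0. Qed.

Lemma connection_factor_shift z : z != 0 ->
  connection_factor q (q * t) z = - (z / t) * connection_factor q t z.
Proof.
move=> z0; rewrite /connection_factor.
have y0 : - (z / t) != 0 by rewrite oppr_eq0 mulf_neq0// invr_eq0.
have -> : - (q * z) / (q * t) = - (z / t) by field; rewrite t0; exact: q0.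
have -> : - (q * z) / t = q * - (z / t) by field; exact: t0.
rewrite (Theta_q q1 y0); move: y0 (Theta q (- (z / t))) => y0 T.
by rewrite !invfM [RHS]mulrCA; congr (_ * _); rewrite [RHS]mulrCA mulVKf.
Qed.

Lemma ae_connection_factor_neq0 : ae_Cstar (fun z => connection_factor q t z != 0).
Proof.
have tv0 : - (q / t) != 0 by rewrite oppr_eq0 mulf_neq0// invr_eq0.
have nq0 : - q != 0 by rewrite oppr_eq0.
apply: ae_imply2 (ae_Theta_neq0 q1 q0) (ae_and (ae_Theta_neq0 q1 nq0) (ae_Theta_neq0 q1 tv0)).
move=> z T1 [T2 T3]; rewrite /connection_factor (infprod_qpoch q1).
rewrite mulNr in T2; rewrite mulNr mulrAC -mulNr in T3.
apply: mulf_neq0; first by apply: mulf_neq0; apply: expf_neq0; [exact: T1|exact: (qpoch_p_neq0 p1)].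
by rewrite invr_eq0; apply: mulf_neq0; [exact: T2|exact: T3].
Qed.

Lemma pseudo_constant_iff (K V : 'M[C]_2) (b : 'I_2 -> C) (P1 P2 Q1 Q2 : C -> 'M[C]_2) :
  V \in unitmx -> (forall i, b i != 0) -> K \in unitmx ->
  let B := diag_in V b in
  mero_eq Q1 (fun z => connection_factor q t z *: (K *m K *m P1 z *m
      invmx (LambdaM q (invmx B) z) *m (q *: LambdaM q (t^-1 *: invmx B) z))) ->
  mero_eq Q2 (fun z => connection_factor q (q * t) z *: (K *m K *m P2 z *m
      invmx (LambdaM q (invmx B) z) *m (q *: LambdaM q ((q * t)^-1 *: invmx B) z))) ->
  mero_eq Q2 Q1 <-> mero_eq P2 (fun z => - (P1 z *m (t ^+ 2 *: B))).
Proof.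
move=> Vu b0 Ku B e1 e2.
have bi0 i : (b i)^-1 != 0 by rewrite invr_eq0.
have tbi0 i : t^-1 * (b i)^-1 != 0 by rewrite mulf_neq0// invr_eq0.
have Bu : B \in unitmx by rewrite (diag_in_unit _ Vu); apply/forallP.
have BiE : invmx B = diag_in V (fun i => (b i)^-1) by exact: (diag_inV Vu b0).
have uL0 := ae_LambdaM_unit q1 Vu bi0.
have uLt := ae_LambdaM_unit q1 Vu tbi0.
have K2u : K *m K \in unitmx by rewrite unitmx_mul Ku.
suff main : ae_Cstar (fun z => Q2 z = Q1 z <-> P2 z = - (P1 z *m (t ^+ 2 *: B))).
  by split; apply: ae_imply2 main => z [].
apply: ae_imply2 (ae_and e1 e2) (ae_and (ae_and uL0 uLt) (ae_and (ae_neq 0) ae_connection_factor_neq0)).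
move=> z [E1 E2] [[u0 ut] [z0 cf0]].
apply: (shift_equivalence K2u _ _ Bu cf0 q0 t0 z0 E1 E2 (connection_factor_shift z0)).
- rewrite unitmx_inv BiE; exact: u0.
- rewrite BiE diag_inZ; exact: ut.
- rewrite BiE; exact: (LambdaM_shift q1 Vu bi0 t0 z0).
have comm : LambdaM q (invmx B) z *m invmx B = invmx B *m LambdaM q (invmx B) z.
  rewrite BiE (LambdaM_diag_in q (fun i => (b i)^-1) z Vu).
  have diag_inC (f g : 'I_2 -> C) : diag_in V f *m diag_in V g = diag_in V g *m diag_in V f.
    rewrite [LHS](diag_inM f g Vu) [RHS](diag_inM g f Vu).
    by apply: eq_diag_in => i; rewrite mulrC.
  exact: diag_inC.
rewrite -BiE in u0; move: (LambdaM q (invmx B) z) u0 comm => L u0 comm.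
apply: (can_inj (mulKmx u0)); apply: (can_inj (mulmxK u0)).
rewrite (mulKVmx u0) mulmxA (mulmxKV u0); exact: esym comm.
Qed.

End PseudoConstancy.

Lemma eq_or_distinct_mod_sym (R : realType) (E : set (Cplx R)) (x y : Cplx R) :
  eq_or_distinct_mod E x y -> eq_or_distinct_mod E y x.
Proof.
case=> [->|h]; [by left|right => -[|[|//]] [|[|//]] //= _ _ _].
  exact: (h 1%N 0%N).
exact: (h 0%N 1%N).
Qed.

Theorem theorem5 (R : realType) (q0 logq0 : Cplx R)
    (hq0 : 1 < `|q0|) (hlog : cexp logq0 = q0) :
  exists2 eps0 : R, 0 < eps0 & forall eps : R, 0 < eps < eps0 ->
  forall (q p : Cplx R) (hq : q = qpow logq0 eps) (hp : p = q^-1)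
    (U : set (Cplx R)) (hU0 : ~ U 0) (hUo : open U) (hUc : connected U)
    (hUs : forall (e : R) (t : Cplx R), 0 < e -> U t -> U (qpow logq0 e * t))
    (hUt : forall t : Cplx R, U t -> distinct_mod (qpow_R logq0) [:: -1; 1; t])
    (cA0 cA1 cAt : Cplx R -> 'M[Cplx R]_2)
    (B0 : 'M[Cplx R]_2) (A1 : Cplx R -> 'M[Cplx R]_2)
    (kappa : 'rV[Cplx R]_2) (A2 : 'M[Cplx R]_2) (hA2 : A2 = diag_mx kappa)
    (hdec : forall t : Cplx R, U t -> forall z : Cplx R,
        z != 0 -> z != 1 -> z != t ->
        ((z - 1) * (z - t)) *:
          (1%:M + ((p - 1) * z) *: fuchsian cA0 cA1 cAt z t) =
        t *: B0 + z *: A1 t + z ^+ 2 *: (1%:M + (p - 1) *: A2))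
    (hB0t : forall t : Cplx R, U t -> B0 = 1%:M + (p - 1) *: cA0 t)
    (hA2t : forall t : Cplx R, U t -> A2 = cA0 t + cA1 t + cAt t)
    (hB0u : B0 \in unitmx) (hB0d : diagonalizable B0)
    (hkappa : forall i : 'I_2, 1 + (p - 1) * kappa 0 i != 0)
    (hB0q : forall a b : Cplx R, eigenvalue B0 a -> eigenvalue B0 b ->
        eq_or_distinct_mod (qpow_Z q) a b)
    (hA2q : eq_or_distinct_mod (qpow_Z q)
        (1 + (p - 1) * kappa 0 0) (1 + (p - 1) * kappa 0 1))
    (a1 a2 a3 a4 : Cplx R)
    (ha1 : a1 != 0) (ha2 : a2 != 0) (ha3 : a3 != 0) (ha4 : a4 != 0)
    (hdet : forall t : Cplx R, U t -> forall z : Cplx R,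
        \det (t *: B0 + z *: A1 t + z ^+ 2 *: (1%:M + (p - 1) *: A2)) =
        (1 + (p - 1) * kappa 0 0) * (1 + (p - 1) * kappa 0 1) *
        ((z - t * a1) * (z - t * a2) * (z - a3) * (z - a4)))
    (hres0 : forall t : Cplx R, U t -> nonresonant (cA0 t))
    (hresoo : nonresonant A2)
    (P Q : Cplx R -> Cplx R -> 'M[Cplx R]_2)
    (hP : forall t : Cplx R, U t ->
        Birkhoff_matrix_inv q
          (fun z => 1%:M + ((p - 1) * z) *: fuchsian cA0 cA1 cAt z t)
          (fun z => P z t))
    (hQ : forall t : Cplx R, U t ->
        Birkhoff_matrix_inv q
          (fun z => ((z - 1) * (z - t)) *:
             (1%:M + ((p - 1) * z) *: fuchsian cA0 cA1 cAt z t))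
          (fun z => Q z t)),
  (forall t : Cplx R, U t ->
     mero_eq (fun z => Q z t)
       (fun z =>
          (Theta q (q * z) ^+ 2 * infprod (fun n => (1 - q ^- n.+1) ^+ 2) /
             (Theta q (- (q * z)) * Theta q (- (q * z) / t))) *:
          ((1%:M + (p - 1) *: A2) ^+ 2 *m P z t *m
             invmx (LambdaM q (invmx B0) z) *m
             (q *: LambdaM q (t^-1 *: invmx B0) z)))) /\
  ((forall t : Cplx R, U t ->
      mero_eq (fun z => Q z (q * t)) (fun z => Q z t)) <->
   (forall t : Cplx R, U t ->
      mero_eq (fun z => P z (q * t))
        (fun z => - (P z t *m (t ^+ 2 *: B0))))).
Proof.
(* The bound 1 is an arbitrary choice. *)
exists 1; first exact: ltr01.
move=> eps /andP[eps0 _] q p hq hp U hU0 _ _ hUs _ cA0 cA1 cAt B0 A1 kappa A2 hA2.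
move=> hdec _ _ hB0u hB0d hkappa hB0q hA2q a1 a2 a3 a4 _ _ _ _ hdet _ _ P Q hP hQ.
have q1 : 1 < `|q| by rewrite hq; apply: norm_qpow_gt1 eps0; rewrite hlog.
have q_neq0 : q != 0 by rewrite -normr_gt0; apply: lt_trans q1; exact: ltr01.
have p0 : q^-1 != 0 by rewrite invr_eq0.
have p1 : `|q^-1| < 1 by rewrite normfV invf_lt1 ?normr_gt0.
have [V [b [Vu B0E]]] := diagonalizable_diag_in hB0d.
have b0 i : b i != 0.
  by move: hB0u; rewrite B0E (diag_in_unit _ Vu) => /forallP.
pose k i := 1 + (p - 1) * kappa 0 i.
pose K := 1%:M + (p - 1) *: A2.
have KE : K = diag_in 1%:M k.
  rewrite /diag_in mul1mx invmx1 mulmx1 /K hA2; apply/matrixP => i j.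
  rewrite !mxE; case: eqVneq => [->|_]; first by rewrite !mulr1n.
  by rewrite !mulr0n mulr0 addr0.
have k0 i : k i != 0 := hkappa i.
have Ku : K \in unitmx by rewrite KE (diag_in_unit _ (unitmx1 _ _)); apply/forallP.
(* If x = y the quotient is 1, and q^-(n+1) <> 1. *)
have nonres (x y : Cplx R) n : y != 0 -> (eq_or_distinct_mod (qpow_Z q) x y) ->
    x / y * q^-1 ^+ n.+1 != 1.
  move=> y0 [->|h]; first by rewrite divff// mul1r; exact: expr_neq1.
  apply/eqP => e; apply: (h 0%N 1%N) => //=; exists (Posz n.+1) => //.
  rewrite -exprnP; apply: (mulIf (expf_neq0 n.+1 p0)); rewrite e.
  by rewrite -exprMn divff// expr1n.
have t_neq0 t : U t -> t != 0 by move=> Ut; apply/eqP => t0; apply: hU0; rewrite -t0.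
have b_nonres i j n : (b i)^-1 / (b j)^-1 * q^-1 ^+ n.+1 != 1.
  rewrite invrK (mulrC (b i)^-1); apply: nonres => //.
  by apply: hB0q; rewrite B0E; exact: diag_in_eigenvalue.
have k_nonres i j n : k i / k j * q^-1 ^+ n.+1 != 1.
  apply: nonres => //; elim/ord2_ind: i; elim/ord2_ind: j; try by left.
    exact: hA2q.
  exact: eq_or_distinct_mod_sym.
have formula t : U t -> mero_eq (fun z => Q z t) (fun z => connection_factor q t z *:
    (K *m K *m P z t *m invmx (LambdaM q (invmx B0) z) *m (q *: LambdaM q (t^-1 *: invmx B0) z))).
  move=> Ut.
  have Du : ae_Cstar (fun z => t *: B0 + z *: A1 t + z ^+ 2 *: K \in unitmx).
    apply: ae_imply2 (ae_and (ae_neq (t * a1)) (ae_neq (t * a2)))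
      (ae_and (ae_neq a3) (ae_neq a4)) => z [z1 z2] [z3 z4].
    by rewrite unitmxE unitfE hdet// !mulf_neq0 ?subr_eq0//; exact: hkappa.
  exact: (connection_formula q1 (t_neq0 t Ut) Vu b0 k0 B0E KE (hdec t Ut) Du
    b_nonres k_nonres (hP t Ut) (hQ t Ut)).
split=> [t Ut|].
  by rewrite expr2; exact: formula.
have Uq t : U t -> U (q * t) by move=> Ut; rewrite hq; exact: hUs.
have equiv t : U t -> mero_eq (fun z => Q z (q * t)) (fun z => Q z t) <->
    mero_eq (fun z => P z (q * t)) (fun z => - (P z t *m (t ^+ 2 *: B0))).
  move=> Ut; have f1 := formula t Ut; have f2 := formula _ (Uq t Ut).
  rewrite B0E in f1 f2 *.
  exact: (pseudo_constant_iff q1 (t_neq0 t Ut) Vu b0 Ku f1 f2).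
by split=> h t Ut; apply/equiv => //; exact: h.
Qed.
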